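(* Let $\Omega\subset\mathbb{R}^3$ be a bounded domain, $\mu>0$, $N\ge 1$. Let $(\mathcal{S}^i)_{i=1}^N$ be compact connected subsets of $\mathbb{R}^3$ with nonempty interior and $\mathcal{S}^i=\mathrm{cl}[\mathrm{int}[\mathcal{S}^i]]$, and let their initial positions $\mathcal{S}^i(0)=\sigma_i(0)[\mathcal{S}^i]$ (images under given orientation-preserving affine isometries $\sigma_i(0)$) satisfy $\mathrm{int}[\mathcal{S}^i(0)]\subset\Omega$ for all $i$ and $\mathrm{int}[\mathcal{S}^i(0)]\cap\mathrm{int}[\mathcal{S}^j(0)]=\emptyset$ whenever $i\neq j$. Let the mass densities $\varrho_{\mathcal{S}^i}$ be positive constants with $0<\underline{\varrho}\le\varrho_{\mathcal{S}^i}\le\overline{\varrho}$ for all $i=1,\dots,N$. Suppose the volume force is $\mathbf{g}=0$. Let $C_{K,P}>0$ be a (Korn--Poincaré) constant such that $C_{K,P}\int_\Omega|\mathbf{v}|^2dx\le\int_\Omega\mathbb{S}(\mathbb{D}_x\mathbf{v}):\mathbb{D}_x\mathbf{v}\,dx$ for all $\mathbf{v}\in W^{1,2}_0(\Omega;\mathbb{R}^3)$. Then for any dissipative weak solution $(\varrho,\mathbf{u})$, $(\mathcal{S}^1(t),\dots,\mathcal{S}^N(t))_{t\ge0}$ of the fluid--structure interaction problem (in the sense defined in the context) with finite energy initial data $(\varrho_0,\mathbf{u}_0)$, the kinetic energy of the system tends exponentially to zero: $$\int_\Omega\varrho|\mathbf{u}|^2(\tau,\cdot)\,dx\le\exp\Big(-\frac{2C_{K,P}}{\overline{\varrho}}\,\tau\Big)\int_\Omega\varrho_0|\mathbf{u}_0|^2dx,\quad\tau\ge0.$$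 In particular, $$\mathbf{h}_i(\tau)\to\mathbf{h}_i^\infty,\qquad|\mathbb{Q}_i(\tau)|\to0\quad\text{as }\tau\to\infty,$$ for some points $\mathbf{h}_i^\infty$, $i=1,\dots,N$.
   Context: Notation: $\mathbb{D}_x\mathbf{u}=\frac12(\nabla_x\mathbf{u}+\nabla_x^t\mathbf{u})$ and $\mathbb{S}(\mathbb{D}_x\mathbf{u})=\mu\,\mathbb{D}_x\mathbf{u}$, where $\mu>0$ is a constant. The fluid density is $1$. The reference bodies $\mathcal{S}^i$ are normalized to have center of mass at the origin. Finite energy initial data: a pair $(\varrho_0,\mathbf{u}_0)$ with $\varrho_0=1$ a.e. in $\Omega\setminus\bigcup_{i}\mathcal{S}^i(0)$, $\varrho_0=\varrho_{\mathcal{S}^i}$ a.e. in $\mathcal{S}^i(0)$, and $\mathbf{u}_0\in L^2(\Omega;\mathbb{R}^3)$, so that $\int_\Omega\varrho_0|\mathbf{u}_0|^2\,dx<\infty$, $\mathbf{u}_0$ being solenoidal with zero normal trace on $\partial\Omega$ (in the weak sense) and coinciding with a rigid velocity on each $\mathcal{S}^i(0)$. Dissipative weak solution (with volume force $\mathbf{g}$): functions $(\varrho,\mathbf{u})$ on $(0,\infty)\times\Omega$ and families $(\mathcal{S}^1(t),\dots,\mathcal{S}^N(t))_{t\ge0}$ such that: (1) Motion of the bodies: $\mathcal{S}^i(t)=\sigma_i(t)[\mathcal{S}^i]$, where $\sigma_i(t)x=\mathbb{O}_i(t)x+\mathbf{h}_i(t)$, $\mathbb{O}_i(t)\in SO(3)$,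 $\mathbf{h}_i(t)\in\mathbb{R}^3$ is the center of mass of $\mathcal{S}^i(t)$, and $\sigma_i(0)$ is the given initial isometry. Put $\mathbf{Y}_i=\frac{d}{dt}\mathbf{h}_i\in L^\infty_{\rm loc}([0,\infty);\mathbb{R}^3)$ and $\mathbb{Q}_i=\frac{d}{dt}\mathbb{O}_i\,\mathbb{O}_i^{-1}\in L^\infty_{\rm loc}([0,\infty);\mathbb{R}^{3\times3})$ (skew-symmetric), and define the rigid velocity $\mathbf{u}_{\mathcal{S}^i}(t,x)=\mathbf{Y}_i(t)+\mathbb{Q}_i(t)(x-\mathbf{h}_i(t))$. (2) Regularity: $\varrho\in C([0,\infty);L^1(\Omega))\cap L^\infty((0,\infty)\times\Omega)$ and $\mathbf{u}\in L^\infty([0,\infty);L^2(\Omega;\mathbb{R}^3))\cap L^2(0,\infty;W^{1,2}_0(\Omega;\mathbb{R}^3))$, $\mathrm{div}_x\mathbf{u}=0$. (3) Compatibility: for a.a. $t>0$, $\varrho(t,x)=1$ for $x\in\Omega\setminus\bigcup_i\mathcal{S}^i(t)$ and $\varrho(t,x)=\varrho_{\mathcal{S}^i}$ for $x\in\mathcal{S}^i(t)$; moreover $\mathbf{u}(t,x)=\mathbf{u}_{\mathcal{S}^i}(t,x)$ for $x\in\mathcal{S}^i(t)$, $i=1,\dots,N$. (4) Continuity equation: $\int_0^\infty\int_\Omega[\varrho\,\partial_t\varphi+\varrho\mathbf{u}\cdot\nabla_x\varphi]\,dx\,dt=-\int_\Omega\varrho_0\varphi(0,\cdot)\,dx$ for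 all $\varphi\in C^1_c([0,\infty)\times\overline{\Omega})$. (5) Momentum balance: $$\int_0^\infty\int_\Omega\big[\varrho\mathbf{u}\cdot\partial_t\boldsymbol{\varphi}+\varrho\mathbf{u}\otimes\mathbf{u}:\nabla_x\boldsymbol{\varphi}-\mathbb{S}(\mathbb{D}_x\mathbf{u}):\mathbb{D}_x\boldsymbol{\varphi}\big]dx\,dt=-\int_0^\infty\int_\Omega\varrho\mathbf{g}\cdot\boldsymbol{\varphi}\,dx\,dt-\int_\Omega\varrho_0\mathbf{u}_0\cdot\boldsymbol{\varphi}(0,\cdot)\,dx$$ for all $\boldsymbol{\varphi}\in C^1_c([0,\infty)\times\Omega;\mathbb{R}^3)$ with $\mathrm{div}_x\boldsymbol{\varphi}=0$ and $\mathbb{D}_x\boldsymbol{\varphi}(t,\cdot)=0$ on an open neighbourhood of $\mathcal{S}^i(t)$ for $i=1,\dots,N$. (6) Energy inequality in differential form: $$-\int_0^\infty\partial_t\psi\int_\Omega\tfrac12\varrho|\mathbf{u}|^2dx\,dt+\int_0^\infty\psi\int_\Omega\mathbb{S}(\mathbb{D}_x\mathbf{u}):\mathbb{D}_x\mathbf{u}\,dx\,dt\le\tfrac12\psi(0)\int_\Omega\varrho_0|\mathbf{u}_0|^2dx+\int_0^\infty\psi\int_\Omega\varrho\mathbf{g}\cdot\mathbf{u}\,dx\,dt$$ for all $\psi\in C^1_c([0,\infty))$, $\psi\ge0$.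
   Formalization: The upper bound on the densities is also assumed to be at least 1, the fluid density (the stated rate fails for very light bodies otherwise); the energy decay is for a.a. τ, |Q_i|→0 is an essential limit, and u is extended by zero outside Ω. *)

(* Defs.v *)
From HB Require Import structures.
From mathcomp Require Import all_boot all_order all_algebra.
From mathcomp Require Import all_classical all_reals all_analysis.

Set Implicit Arguments.
Unset Strict Implicit.
Unset Printing Implicit Defensive.

Import Order.TTheory GRing.Theory Num.Theory.
Import numFieldNormedType.Exports.
Local Open Scope classical_set_scope.
Local Open Scope ring_scope.

(* Points of R^3 are triples, so that Lebesgue measure is an iterated product
   and the topology is the product topology; velocities, translations and
   rotations are column vectors and matrices. *)
Notation pt R := (R * R * R)%type.

Section calculus.
Context {R : realType}.

Definition leb1 := @lebesgue_measure R.
Definition leb3 := ((leb1 \x leb1) \x leb1)%E.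
Definition leb4 := (leb1 \x leb3)%E.

Definition halfline : set R := `[0, +oo[.

Definition coords (x : pt R) : 'cV[R]_3 :=
  \col_(k < 3) nth 0 [:: x.1.1; x.1.2; x.2] k.

Definition of_coords (v : 'cV[R]_3) : pt R := (v 0 0, v 1 0, v ord_max 0).

Definition evec (j : 'I_3) : pt R := of_coords (delta_mx j 0).

(* The contraction A : B of matrices; for column vectors it is the Euclidean
   inner product. *)
Definition ddot m n (A B : 'M[R]_(m, n)) : R := \sum_i \sum_j A i j * B i j.

Definition sqnorm m n (A : 'M[R]_(m, n)) : R := ddot A A.

Definition sym (A : 'M[R]_3) : 'M[R]_3 := 2^-1 *: (A + A^T).

Definition stress (mu : R) (D : 'M[R]_3) : 'M[R]_3 := mu *: D.

Definition C1 (E : normedModType R) (f : E -> R) : Prop :=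
  forall v, (forall x, derivable f x v) /\ continuous ('D_v f).

(* [foldr] produces all the iterated directional derivatives of [f]. *)
Definition smooth (E : normedModType R) (f : E -> R) : Prop :=
  forall vs : seq E, C1 (foldr (fun v g => 'D_v g) f vs).

Definition grad (f : pt R -> R) (x : pt R) : 'cV[R]_3 :=
  \col_(j < 3) 'D_(evec j) f x.

Definition jac (f : pt R -> 'cV[R]_3) (x : pt R) : 'M[R]_3 :=
  \matrix_(i < 3, j < 3) 'D_(evec j) (fun y => f y i 0) x.

(* Time derivatives of functions of the pair (t, x). *)
Definition dt (f : R * pt R -> R) (t : R) (x : pt R) : R :=
  'D_((1, 0) : R * pt R) f (t, x).

Definition dtv (f : R * pt R -> 'cV[R]_3) (t : R) (x : pt R) : 'cV[R]_3 :=
  \col_(i < 3) dt (fun p => f p i 0) t x.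

Definition mx_measurable d (T : measurableType d) m n
    (D : set T) (f : T -> 'M[R]_(m, n)) : Prop :=
  forall i j, measurable_fun D (fun x => f x i j).

End calculus.

Section Sobolev.
Context {R : realType}.
Implicit Types (Om : set (pt R)) (v : pt R -> 'cV[R]_3) (G : pt R -> 'M[R]_3).

Definition L2 m n Om (f : pt R -> 'M[R]_(m, n)) : Prop :=
  mx_measurable Om f /\
  (\int[leb3]_(x in Om) (sqnorm (f x))%:E < +oo)%E.

Definition compact_support Om (V : zmodType) (f : pt R -> V) : Prop :=
  exists K, [/\ compact K, K `<=` Om & forall x, ~ K x -> f x = 0].

Definition Cc_smooth Om (f : pt R -> R) : Prop :=
  smooth f /\ compact_support Om f.

Definition weak_gradient Om v G : Prop :=
  forall f, Cc_smooth Om f -> forall i j : 'I_3,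
    \int[leb3]_(x in Om) (v x i 0 * 'D_(evec j) f x) =
    - (\int[leb3]_(x in Om) (G x i j * f x)).

(* [v] belongs to W^{1,2}(Om; R^3) and [G] is its weak gradient; the gradient,
   unique up to null sets, is carried along explicitly. *)
Definition W12 Om v G : Prop :=
  [/\ L2 Om v, L2 Om G & weak_gradient Om v G].

(* The closure of the smooth compactly supported fields in W^{1,2}. *)
Definition W120 Om v G : Prop :=
  W12 Om v G /\
  exists f : nat -> pt R -> 'cV[R]_3,
    (forall n (i : 'I_3), Cc_smooth Om (fun x => f n x i 0)) /\
    (\int[leb3]_(x in Om)
       (sqnorm (f n x - v x) + sqnorm (jac (f n) x - G x))%:E)%E
      @[n --> \oo] --> 0%E.

End Sobolev.

Section rigid_bodies.
Context {R : realType}.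

Definition SO3 (A : 'M[R]_3) : Prop := A^T *m A = 1%:M /\ \det A = 1.

Definition affine_isometry (A : 'M[R]_3) (h : 'cV[R]_3) (x : pt R) : pt R :=
  of_coords (A *m coords x + h).

Definition rigid_velocity (Y : 'cV[R]_3) (Q : 'M[R]_3) (h : 'cV[R]_3)
    (x : pt R) : 'cV[R]_3 :=
  Y + Q *m (coords x - h).

(* The bodies being homogeneous, the center of mass is the centroid. *)
Definition center_of_mass (S : set (pt R)) : 'cV[R]_3 :=
  \col_(k < 3) ((\int[leb3]_(x in S) coords x k 0) / fine (leb3 S)).

Definition Linfty_loc m n (f : R -> 'M[R]_(m, n)) : Prop :=
  mx_measurable halfline f /\
  forall T : R, exists M : R, {ae leb1, forall t : R, 0 <= t <= T ->
    forall i j, `|f t i j| <= M}.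

(* [f] is absolutely continuous on [0, +oo) with derivative [f'] almost
   everywhere. *)
Definition time_derivative m n (f f' : R -> 'M[R]_(m, n)) : Prop :=
  forall t : R, 0 <= t -> forall i j,
    f t i j = f 0 i j + (\int[leb1]_(s in `[0, t]) f' s i j).

End rigid_bodies.

Section fluid_structure.
Context {R : realType} {N : nat}.
Variables (Om : set (pt R)) (S : 'I_N -> set (pt R))
  (A0 : 'I_N -> 'M[R]_3) (h0 : 'I_N -> 'cV[R]_3) (rhoS : 'I_N -> R)
  (mu : R) (g : R -> pt R -> 'cV[R]_3)
  (rho0 : pt R -> R) (u0 : pt R -> 'cV[R]_3).

Definition initial_body (i : 'I_N) : set (pt R) :=
  affine_isometry (A0 i) (h0 i) @` S i.

Record finite_energy_data : Prop := FiniteEnergyData {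
  rho0_measurable : measurable_fun Om rho0 ;
  rho0_fluid : {ae leb3, forall x : pt R, Om x ->
    (forall i, ~ initial_body i x) -> rho0 x = 1} ;
  rho0_body : forall i, {ae leb3, forall x : pt R, Om x ->
    initial_body i x -> rho0 x = rhoS i} ;
  u0_L2 : L2 Om u0 ;
  finite_energy :
    (\int[leb3]_(x in Om) (rho0 x * sqnorm (u0 x))%:E < +oo)%E ;
  (* Solenoidality and vanishing of the normal trace, in the weak sense. *)
  u0_solenoidal : forall f : pt R -> R, C1 f ->
    \int[leb3]_(x in Om) ddot (u0 x) (grad f x) = 0 ;
  u0_rigid : forall i, exists Y Q, Q^T = - Q /\
    {ae leb3, forall x : pt R, Om x -> initial_body i x ->
      u0 x = rigid_velocity Y Q (h0 i) x} }.

Definition body (A : 'I_N -> R -> 'M[R]_3) (h : 'I_N -> R -> 'cV[R]_3)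
    (i : 'I_N) (t : R) : set (pt R) :=
  affine_isometry (A i t) (h i t) @` S i.

(* Test functions on [0, +oo) x cl(Om), resp. [0, +oo) x Om, are restrictions
   of C^1 functions on the whole space-time. For bounded [Om], compactness of
   the support in [0, +oo) x cl(Om) only restricts time. *)
Definition continuity_test (f : R * pt R -> R) : Prop :=
  C1 f /\ exists T : R, forall t x, T <= t -> f (t, x) = 0.

Definition momentum_test (B : 'I_N -> R -> set (pt R))
    (f : R * pt R -> 'cV[R]_3) : Prop :=
  [/\ forall i : 'I_3, C1 (fun p => f p i 0),
      exists (T : R) (K : set (pt R)), [/\ compact K, K `<=` Om &
        forall (t : R) x, 0 <= t -> T <= t \/ ~ K x -> f (t, x) = 0],
      forall (t : R) x, 0 <= t -> \tr (jac (fun y => f (t, y)) x) = 0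
    & forall i (t : R), 0 <= t -> exists U : set (pt R),
        [/\ open U, B i t `<=` U &
         forall x, U x -> sym (jac (fun y => f (t, y)) x) = 0]].

Definition energy_test (psi : R -> R) : Prop :=
  [/\ C1 psi, exists T : R, forall t, T <= t -> psi t = 0
    & forall t : R, 0 <= t -> 0 <= psi t].

(* [Du] is the spatial weak gradient of [u]; [A i], [h i] describe the motion
   of the i-th body, with translational velocity [Y i] and angular velocity
   matrix [Q i]. *)
Record dissipative_weak_solution
    (rho : R -> pt R -> R) (u : R -> pt R -> 'cV[R]_3)
    (Du : R -> pt R -> 'M[R]_3)
    (A : 'I_N -> R -> 'M[R]_3) (h : 'I_N -> R -> 'cV[R]_3)
    (Y : 'I_N -> R -> 'cV[R]_3) (Q : 'I_N -> R -> 'M[R]_3) : Prop :=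
  DissipativeWeakSolution {
  motion_SO3 : forall i (t : R), 0 <= t -> SO3 (A i t) ;
  motion_center : forall i (t : R), 0 <= t ->
    center_of_mass (body A h i t) = h i t ;
  motion_initial : forall i, A i 0 = A0 i /\ h i 0 = h0 i ;
  motion_Y : forall i, Linfty_loc (Y i) /\ time_derivative (h i) (Y i) ;
  (* Q = A' A^-1, that is, A' = Q A. *)
  motion_Q : forall i, Linfty_loc (Q i) /\
    time_derivative (A i) (fun t => Q i t *m A i t) ;
  motion_skew : forall i,
    {ae leb1, forall t : R, 0 < t -> (Q i t)^T = - Q i t} ;

  rho_measurable :
    measurable_fun (halfline `*` Om) (fun p : R * pt R => rho p.1 p.2) ;
  rho_L1 : forall t : R, 0 <= t -> leb3.-integrable Om (EFin \o rho t) ;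
  rho_continuous : forall s : R, 0 <= s ->
    (\int[leb3]_(x in Om) `|rho t x - rho s x|%:E)%E
      @[t --> within halfline (nbhs s)] --> 0%E ;
  rho_bounded : exists M : R, {ae leb4, forall p : R * pt R,
    0 < p.1 -> Om p.2 -> `|rho p.1 p.2| <= M} ;

  u_measurable :
    mx_measurable (halfline `*` Om) (fun p : R * pt R => u p.1 p.2) ;
  Du_measurable :
    mx_measurable (halfline `*` Om) (fun p : R * pt R => Du p.1 p.2) ;
  u_Linfty_L2 : exists M : R, {ae leb1, forall t : R, 0 <= t ->
    (\int[leb3]_(x in Om) (sqnorm (u t x))%:E <= M%:E)%E} ;
  u_W120 : {ae leb1, forall t : R, 0 < t -> W120 Om (u t) (Du t)} ;
  u_L2_W12 : (\int[leb1]_(t in halfline) \int[leb3]_(x in Om)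
    (sqnorm (u t x) + sqnorm (Du t x))%:E < +oo)%E ;
  u_div : {ae leb1, forall t : R, 0 < t ->
    {ae leb3, forall x : pt R, Om x -> \tr (Du t x) = 0}} ;

  compat_fluid : {ae leb1, forall t : R, 0 < t ->
    {ae leb3, forall x : pt R,
      Om x -> (forall i, ~ body A h i t x) -> rho t x = 1}} ;
  compat_body : forall i, {ae leb1, forall t : R, 0 < t ->
    {ae leb3, forall x : pt R, Om x -> body A h i t x -> rho t x = rhoS i}} ;
  (* As an element of W^{1,2}_0, the velocity is extended by zero outside
     [Om]. *)
  compat_velocity : forall i, {ae leb1, forall t : R, 0 < t ->
    {ae leb3, forall x : pt R, body A h i t x ->
      \1_Om x *: u t x = rigid_velocity (Y i t) (Q i t) (h i t) x}} ;

  continuity_equation : forall f, continuity_test f ->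
    \int[leb1]_(t in halfline) \int[leb3]_(x in Om)
      (rho t x * dt f t x
       + rho t x * ddot (u t x) (grad (fun y => f (t, y)) x)) =
    - \int[leb3]_(x in Om) (rho0 x * f (0, x)) ;

  momentum_balance : forall f, momentum_test (body A h) f ->
    \int[leb1]_(t in halfline) \int[leb3]_(x in Om)
      (rho t x * ddot (u t x) (dtv f t x)
       + rho t x * ddot (u t x *m (u t x)^T) (jac (fun y => f (t, y)) x)
       - ddot (stress mu (sym (Du t x))) (sym (jac (fun y => f (t, y)) x))) =
    - (\int[leb1]_(t in halfline) \int[leb3]_(x in Om)
         (rho t x * ddot (g t x) (f (t, x))))
    - (\int[leb3]_(x in Om) (rho0 x * ddot (u0 x) (f (0, x)))) ;

  energy_inequality : forall psi, energy_test psi ->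
    - (\int[leb1]_(t in halfline) (derive1 psi t *
         \int[leb3]_(x in Om) (2^-1 * rho t x * sqnorm (u t x))))
    + (\int[leb1]_(t in halfline) (psi t *
         \int[leb3]_(x in Om)
           ddot (stress mu (sym (Du t x))) (sym (Du t x)))) <=
    2^-1 * psi 0 * (\int[leb3]_(x in Om) (rho0 x * sqnorm (u0 x)))
    + (\int[leb1]_(t in halfline) (psi t *
         \int[leb3]_(x in Om) (rho t x * ddot (g t x) (u t x)))) }.

End fluid_structure.

(* Main.v *)
(** Testing the energy inequality with [exp(l t) k(t)], where k is a decreasing
cutoff and l = 2 CKP / rhomax, the Korn-Poincare inequality absorbs the
derivative of the exponential into the dissipation. What remains says that the
average of [exp(l t) E(t)] over every time interval is at most the initial
energy, hence so is its value at almost every t, by Lebesgue differentiation.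

Each body contains a cube of fixed size, on which u is a rigid velocity. At any
time and for each component of this velocity, which is an affine function of x,
one of the eight corners of the cube, again of fixed size, is such that the
terms of the function do not cancel there. The energy thus controls |Q|^2 and
|Y|^2 with constants independent of time, so that Y and Q decay exponentially
and h is Cauchy at infinity. *)

Require Import Defs.
From HB Require Import structures.
From mathcomp Require Import all_boot all_order all_algebra.
From mathcomp Require Import all_classical all_reals all_analysis.
From mathcomp Require Import measurable_realfun ring lra.

Set Implicit Arguments.
Unset Strict Implicit.

Import Order.TTheory GRing.Theory Num.Theory.
Import numFieldNormedType.Exports.
Local Open Scope classical_set_scope.
Local Open Scope ring_scope.

(** * One-variable calculus for the test functions of the energy inequality *)

Lemma C1_is_derive1 (R : realType) (f f' : R -> R) :
  (forall x : R, is_derive x 1 f (f' x)) -> continuous f' -> C1 f.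
Proof.
move=> df cf' v.
have dif x : differentiable f x.
  by apply/derivable1_diffP; exact: (@ex_derive _ _ _ _ _ _ _ (df x)).
split=> [x|]; first exact: diff_derivable.
(* The derivative is linear in the direction, so [v] only contributes a scalar factor. *)
have -> : 'D_v f = fun x => v * f' x.
  apply/funext => x.
  by rewrite deriveE// diff1E// derive1E (@derive_val _ _ _ _ _ _ _ (df x)).
by move=> x; apply: cvgM; [exact: cvg_cst|exact: cf'].
Qed.

Section expR_linear.
Context {R : realType}.

Lemma is_derive_expRM (c : R) (t : R) :
  is_derive t (1 : R) (fun s => expR (c * s)) (c * expR (c * t)).
Proof.
have dc : is_derive t (1 : R) (fun s : R => c * s) c.
  by apply: is_derive_eq; rewrite /GRing.scale/=; ring.
rewrite mulrC; exact: (is_derive1_comp (is_derive_expR _) dc).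
Qed.

Lemma continuous_expRM (c : R) : continuous (fun s => expR (c * s)).
Proof.
move=> t; apply: (@continuous_comp _ _ _ (fun s : R => c * s) expR).
  by apply: cvgM; [exact: cvg_cst|exact: cvg_id].
exact: continuous_expR.
Qed.

End expR_linear.

(** * A C^1 cutoff with trapezoidal slope *)

Section ramp.
Context {R : realType}.
Implicit Types x : R.

Definition pospart x : R := (x + `|x|) / 2.

Lemma pospart_ge0 x : 0 <= x -> pospart x = x.
Proof. by move=> x0; rewrite /pospart ger0_norm//; lra. Qed.

Lemma pospart_le0 x : x <= 0 -> pospart x = 0.
Proof. by move=> x0; rewrite /pospart ler0_norm//; lra. Qed.

Lemma continuous_pospart : continuous pospart.
Proof.
move=> x; apply: cvgM; last exact: cvg_cst.
by apply: cvgD; [exact: cvg_id|exact: norm_continuous].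
Qed.

(** The primitive of [pospart] that vanishes on the negative half-line; it is C^1, so combinations
    of its translates give C^1 cutoffs. *)
Definition ramp x : R := pospart x ^+ 2 / 2.

Lemma ramp_ge0 x : 0 <= x -> ramp x = x ^+ 2 / 2.
Proof. by move=> x0; rewrite /ramp pospart_ge0. Qed.

Lemma ramp_le0 x : x <= 0 -> ramp x = 0.
Proof. by move=> x0; rewrite /ramp pospart_le0// expr0n mul0r. Qed.

Lemma is_derive_ramp x : is_derive x (1 : R) ramp (pospart x).
Proof.
have [x0|x0|->] := ltgtP x 0.
- rewrite pospart_le0 ?ltW//.
  apply: (@near_eq_is_derive _ R R (cst 0)).
  near=> y; rewrite /= ramp_le0//; apply: ltW; near: y.
  exact: lt_nbhsl.
- rewrite pospart_ge0 ?ltW//.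
  have dsq : is_derive x (1 : R) (fun y : R => y ^+ 2 / 2 : R) x.
    by apply: is_derive_eq; rewrite /GRing.scale/=; field.
  apply: near_eq_is_derive dsq.
  near=> y; rewrite /= ramp_ge0//; apply: ltW; near: y.
  exact: lt_nbhsr.
(* At the kink the difference quotient is [pospart h / 2] on both sides, and tends to 0. *)
have r0 : ramp 0 = 0 by rewrite ramp_le0.
have cv : h^-1 *: (ramp (h *: 1 + 0) - ramp 0) @[h --> 0^'] --> pospart 0.
  have cp : pospart h / 2 @[h --> (0 : R)^'] --> pospart (0 : R).
    have -> : pospart (0 : R) = pospart 0 / 2 by rewrite pospart_le0// mul0r.
    apply: cvgM; last exact: cvg_cst.
    by apply: cvg_within_filter; exact: continuous_pospart.
  apply: cvg_trans cp.
  apply: near_eq_cvg; near=> h.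
  have h0 : h != 0 by near: h; exact: nbhs_dnbhs_neq.
  rewrite /GRing.scale/= mulr1 addr0 r0 subr0.
  case: (leP 0 h) => hs; first by rewrite ramp_ge0// pospart_ge0//; field.
  by rewrite ramp_le0 ?pospart_le0 ?ltW// mulr0 mul0r.
apply: DeriveDef; last exact: cvg_lim.
by apply/cvg_ex; exists (pospart 0).
Unshelve. all: by end_near. Qed.

End ramp.

Section cutoff.
Context {R : realType}.
Variables a b d : R.

(** For [a <= b] and [0 < d], the continuous function equal to 1 on [a, b] and to 0 off
    [a - d, b + d], affine in between. *)
Definition trapezoid (s : R) : R :=
  (pospart (s - a + d) - pospart (s - a) - pospart (s - b)
   + pospart (s - b - d)) / d.

(** The integral of [trapezoid] from [s] to infinity; the constant [b - a + d] is the total area of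
    the trapezoid. *)
Definition cutoff (s : R) : R :=
  b - a + d - (ramp (s - a + d) - ramp (s - a) - ramp (s - b)
               + ramp (s - b - d)) / d.

Lemma is_derive_cutoff s : is_derive s (1 : R) cutoff (- trapezoid s).
Proof.
have rc (c : R) : is_derive s (1 : R) (fun s => ramp (s + c)) (pospart (s + c)).
  have ? := is_derive_ramp (s + c).
  by apply: is_derive_eq; rewrite /GRing.scale/= ?(addr0, mulr1).
have -> : cutoff = cst (b - a + d) - d^-1 *: (
    (fun s => ramp (s + (d - a))) - (fun s => ramp (s + - a))
    - (fun s => ramp (s + - b)) + (fun s => ramp (s + (- b - d)))).
  by apply/funext => t; rewrite /cutoff -!addrA [- a + d]addrC mulrC.
have r1 := rc (d - a); have r2 := rc (- a); have r3 := rc (- b).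
have r4 := rc (- b - d).
have dr := is_deriveD (is_deriveB (is_deriveB r1 r2) r3) r4.
have := is_deriveB (is_derive_cst (b - a + d) s 1) (is_deriveZ d^-1 dr).
rewrite /trapezoid -!addrA [- a + d]addrC sub0r /GRing.scale/= [_ / d]mulrC.
by [].
Qed.

Lemma continuous_trapezoid : continuous trapezoid.
Proof.
have cp (c : R) : continuous (fun s : R => pospart (s + c)).
  move=> s; apply: (@continuous_comp _ _ _ (fun s : R => s + c) pospart); last first.
    exact: continuous_pospart.
  by apply: cvgD; [exact: cvg_id|exact: cvg_cst].
have -> : trapezoid = (fun s : R => (pospart (s + (d - a)) - pospart (s + - a)
    - pospart (s + - b) + pospart (s + (- b - d))) / d).
  by apply/funext => t; rewrite /trapezoid -!addrA [- a + d]addrC.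
move=> s; apply: cvgM; last exact: cvg_cst.
by apply: cvgD; [apply: cvgB; [apply: cvgB|]|]; exact: cp.
Qed.

(** Splits inequalities between positive parts into finitely many polynomial cases for [lra] and
    [nra]. *)
Let pos_cases (x : R) : (x <= 0 /\ pospart x = 0) \/ (0 <= x /\ pospart x = x).
Proof.
case: (leP x 0) => x0; [left|right]; first by rewrite pospart_le0.
by rewrite ltW// pospart_ge0// ltW.
Qed.

Lemma trapezoid_ge0 s : a <= b -> 0 < d ->
  0 <= trapezoid s.
Proof.
move=> ab d0.
apply: divr_ge0; last exact: ltW.
have := pos_cases (s - a + d); have := pos_cases (s - a).
have := pos_cases (s - b); have := pos_cases (s - b - d).
by case=> -[? ->] [] [? ->] [] [? ->] [] [? ->]; lra.
Qed.

Lemma trapezoid_eq1 s : a <= b -> 0 < d ->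
  a <= s <= b -> trapezoid s = 1.
Proof.
move=> ab d0.
move=> /andP[sa sb]; rewrite /trapezoid pospart_ge0; last lra.
rewrite pospart_ge0; last lra.
rewrite pospart_le0; last lra.
rewrite pospart_le0; last lra.
by field; rewrite gt_eqF.
Qed.

Lemma trapezoid_eq0 s : a <= b -> 0 < d ->
  b + d <= s -> trapezoid s = 0.
Proof.
move=> ab d0.
move=> bs; rewrite /trapezoid !pospart_ge0; [|lra..].
by field; rewrite gt_eqF.
Qed.

Lemma cutoff_eq0 s : a <= b -> 0 < d ->
  b + d <= s -> cutoff s = 0.
Proof.
move=> ab d0.
move=> bs; rewrite /cutoff !ramp_ge0; [|lra..].
by field; rewrite gt_eqF.
Qed.

Lemma cutoff_ge0 s : a <= b -> 0 < d ->
  0 <= cutoff s.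
Proof.
move=> ab d0.
suff : ramp (s - a + d) - ramp (s - a) - ramp (s - b) + ramp (s - b - d)
    <= (b - a + d) * d.
  by rewrite -ler_pdivrMr// /cutoff; lra.
have := pos_cases (s - a + d); have := pos_cases (s - a).
have := pos_cases (s - b); have := pos_cases (s - b - d).
by rewrite /ramp; case=> -[? ->] [] [? ->] [] [? ->] [] [? ->]; nra.
Qed.

Lemma cutoff_le s : a <= b -> 0 < d ->
  cutoff s <= b - a + d.
Proof.
move=> ab d0.
suff : 0 <= (ramp (s - a + d) - ramp (s - a) - ramp (s - b)
             + ramp (s - b - d)) / d by rewrite /cutoff; lra.
apply: divr_ge0; last exact: ltW.
have := pos_cases (s - a + d); have := pos_cases (s - a).
have := pos_cases (s - b); have := pos_cases (s - b - d).
by rewrite /ramp; case=> -[? ->] [] [? ->] [] [? ->] [] [? ->]; nra.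
Qed.

End cutoff.

(** * Exponential decay from a weak energy inequality *)

Section ae_integral.
Context d (T : measurableType d) (R : realType) (mu : {measure set T -> \bar R}).
Implicit Types (D : set T) (f g : T -> R).

Lemma ae_imp (P Q : T -> Prop) : (forall x, P x -> Q x) ->
  {ae mu, forall x, P x} -> {ae mu, forall x, Q x}.
Proof. by move=> PQ; apply: negligibleS => x /=; apply: contra_not; exact: PQ. Qed.

Lemma ae_imp2 (P1 P2 Q : T -> Prop) : (forall x, P1 x -> P2 x -> Q x) ->
  {ae mu, forall x, P1 x} -> {ae mu, forall x, P2 x} -> {ae mu, forall x, Q x}.
Proof.
move=> PQ P1ae P2ae; apply: negligibleS (negligibleU P1ae P2ae) => x /= Qx.
apply: contrapT => /not_orP[] /= /contrapT P1x /contrapT P2x.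
exact: Qx (PQ _ P1x P2x).
Qed.

Lemma ae_forall_fin (I : finType) (P : I -> T -> Prop) :
  (forall i, {ae mu, forall x, P i x}) -> {ae mu, forall x, forall i, P i x}.
Proof. exact: (@filter_forall _ _ _ _ (ae_filter_ringOfSetsType mu)). Qed.

(** The exceptional null set is deleted from the domain. Integrability is required because a
    real-valued integral is the [fine] part of an extended one, and [fine] is monotone only on
    finite values. *)
Lemma le_ae_Rintegral D f g : measurable D ->
  mu.-integrable D (EFin \o f) -> mu.-integrable D (EFin \o g) ->
  {ae mu, forall x, D x -> f x <= g x} ->
  \int[mu]_(x in D) f x <= \int[mu]_(x in D) g x.
Proof.
move=> mD fi gi [N [mN N0 fgN]].
rewrite /Rintegral (negligible_integral mN mD fi N0).
rewrite (negligible_integral mN mD gi N0).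
have DN : D `\` N `<=` D by exact: subDsetl.
have mDN : measurable (D `\` N) by exact: measurableD.
apply: le_Rintegral (integrableS mD mDN DN fi) (integrableS mD mDN DN gi) _ => //.
by move=> x [Dx Nx]; apply: contrapT => fgx; apply: Nx; apply: fgN => /(_ Dx).
Qed.

Lemma integrable_scale D f (k : R) : measurable D ->
  mu.-integrable D (EFin \o f) -> mu.-integrable D (EFin \o (fun x => k * f x)).
Proof. by move=> mD /(integrableZl mD k); apply: eq_integrable. Qed.

Lemma ae_bounded_integrable D f (M : R) : measurable D -> (mu D < +oo)%E ->
  measurable_fun D f -> {ae mu, forall x, D x -> `|f x| <= M} ->
  mu.-integrable D (EFin \o f).
Proof.
move=> mD Doo mf [N [mN N0 fM]].
apply/(negligible_integrable mN mD _ N0); first exact/measurable_EFinP.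
apply: measurable_bounded_integrable.
- exact: measurableD.
- by apply: le_lt_trans Doo; apply: le_measure; rewrite ?inE//; exact: measurableD.
- by apply: measurable_funS mf => //; exact: subDsetl.
- exists M; split; first exact: num_real.
  move=> y My x [Dx Nx]; apply: le_trans (ltW My).
  by apply: contrapT => fgx; apply: Nx; apply: fM => /(_ Dx).
Qed.

End ae_integral.

Section decay.
Context {R : realType}.
Implicit Types (e D f : R -> R).

Lemma measurable_halfline : measurable (@halfline R).
Proof. exact: measurable_itv. Qed.

Lemma halflineE (x : R) : halfline x = (0 <= x) :> Prop.
Proof. by rewrite /halfline/= in_itv/= andbT. Qed.

Lemma segment_halfline (T : R) : `[0, T] `<=` @halfline R.
Proof. by move=> x; rewrite halflineE /= in_itv/= => /andP[]. Qed.

(** The time 0 alone is a null set. *)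
Lemma ae_gt0_ge0 (P : R -> Prop) : {ae leb1, forall t, 0 < t -> P t} ->
  {ae leb1, forall t, 0 <= t -> P t}.
Proof.
have : {ae leb1, forall t : R, t != 0}.
  exists [set 0]; split; [exact: measurable_set1|exact: lebesgue_measure_set1|].
  by move=> t /= /negP; rewrite negbK => /eqP.
by apply: ae_imp2 => t t0 Pt t_ge0; apply: Pt; rewrite lt_neqAle eq_sym t0.
Qed.

Lemma leb1_segment (a b : R) : (leb1 `[a, b] < +oo)%E.
Proof. by rewrite /leb1 lebesgue_measure_itv/=; case: ifPn => // _; exact: ltry. Qed.

Lemma continuous_itv_bounded (k : R -> R) (T : R) : continuous k ->
  [bounded k x | x in `[0, T]].
Proof.
move=> ck; have : compact [set k x | x in `[0, T]].
  by apply: continuous_compact; [exact: continuous_subspaceT|exact: segment_compact].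
move/(@compact_bounded _ R^o) => [M [Mreal kM]]; exists M; split=> // y My x xT.
by apply: kM My _ _; exists x.
Qed.

Lemma bounded_halfline (k : R -> R) (T : R) : continuous k ->
  (forall t, T <= t -> k t = 0) -> [bounded k x | x in halfline].
Proof.
move=> ck k0; have [M [Mreal kM]] := continuous_itv_bounded T ck.
exists `|M|; split; first exact: num_real.
move=> y My x; rewrite halflineE => x0 /=.
have M0 : 0 <= y by apply: le_trans (ltW My).
case: (leP x T) => xT; last by rewrite k0 ?normr0// ltW.
apply: kM; first exact: le_lt_trans (ler_norm _) My.
by rewrite /= in_itv/= x0.
Qed.

(** Past [T] the factor [k] vanishes, so [f] may be replaced by 0 there; and [k] is bounded on
    [halfline]. *)
Lemma integrable_halflineM (k f : R -> R) (T : R) : continuous k ->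
  (forall t, T <= t -> k t = 0) ->
  leb1.-integrable `[0, T] (EFin \o f) ->
  leb1.-integrable halfline (EFin \o (fun t => k t * f t)).
Proof.
move=> ck k0 fi.
have : leb1.-integrable halfline ((EFin \o k) \* ((EFin \o f) \_ `[0%R, T]))%E.
  apply: integrableMr.
  - exact: measurable_halfline.
  - by apply: measurable_funTS; exact: continuous_measurable_fun.
  - exact: bounded_halfline ck k0.
  apply/integrable_restrict; [exact: measurable_itv|exact: measurable_halfline|].
  by rewrite setIidr//; exact: segment_halfline.
apply: eq_integrable; first exact: measurable_halfline.
move=> x; rewrite inE halflineE => x0; rewrite /= patchE/=.
case: ifPn; first by rewrite EFinM.
rewrite notin_setE/= in_itv/= x0/= => /negP; rewrite -ltNge => Tx.
by rewrite mule0 k0 ?mul0r// ltW.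
Qed.

(** Lebesgue differentiation: almost everywhere [f t] is the derivative of a primitive of [f], that
    is, a limit of averages over intervals, each at most [c]. *)
Lemma itv_average_le f (c : R) :
  (forall T : R, leb1.-integrable `[0, T] (EFin \o f)) ->
  (forall a b : R, 0 <= a -> a <= b ->
    \int[leb1]_(x in `[a, b]) f x <= c * (b - a)) ->
  {ae leb1, forall t, 0 < t -> f t <= c}.
Proof.
move=> fi fc.
(* Extension by zero makes [f] locally integrable on the whole line, as [FTC1] requires. *)
pose g := f \_ halfline.
have gi (y : R) : leb1.-integrable `[0, y] (EFin \o g).
  apply: eq_integrable (fi y); first exact: measurable_itv.
  move=> x; rewrite inE/= => xy; rewrite /g patchE mem_set//.
  exact: segment_halfline xy.
have giT (y : R) : leb1.-integrable `]-oo, y] (EFin \o g).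
  have : leb1.-integrable (`]-oo, y] `&` halfline) (EFin \o f).
    apply: integrableS (fi y); [exact: measurable_itv| |].
      by apply: measurableI; [exact: measurable_itv|exact: measurable_halfline].
    by move=> x []; rewrite halflineE /= !in_itv/= => -> ->.
  move/integrable_restrict => /(_ measurable_halfline (measurable_itv _)).
  by rewrite restrict_EFin.
have mg : measurable_fun setT g.
  have -> : [set: R] = \bigcup_n (`]-oo, n%:R]%classic : set R).
    apply/esym; rewrite -subTset => x _; exists (Num.truncn `|x|).+1 => //=.
    by rewrite in_itv/= (le_trans (ler_norm _))// ltW// truncnS_gt.
  apply/measurable_fun_bigcup => [n|n]; first exact: measurable_itv.
  by apply/measurable_EFinP; exact: measurable_int (giT n%:R).
have lg : locally_integrable [set: R] g.
  split=> //; first exact: openT.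
  move=> K _ cK; have [M [_ KM]] := compact_bounded cK.
  have KM1 : K `<=` `]-oo, (M + 1)].
    move=> x /(KM (M + 1)) /=; rewrite in_itv/= ltrDl ltr01 => /(_ isT).
    exact: le_trans (ler_norm _).
  have /integrableP[_ //] : leb1.-integrable K (EFin \o g).
  apply: integrableS (giT (M + 1)) => //.
  exact: compact_measurable.
have := FTC1 (a := BLeft 0) gi lg.
apply: ae_imp => x + x_gt0; rewrite /= lte_fin => /(_ x_gt0)[dG G'].
have x0 := ltW x_gt0.
set G := fun y => _ in dG G'.
(* Increments to the right suffice, and keep the intervals inside [halfline]. *)
have cG : h^-1 *: (G (h *: 1 + x) - G x) @[h --> (0 : R)^'+] --> f x.
  have -> : f x = 'D_1 G x.
    by rewrite -derive1E G' /g patchE mem_set// halflineE.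
  exact/cvg_dnbhs_at_right/dG.
apply: cvgr_to_le cG _; near=> h.
have h0 : 0 < h by near: h; exact: nbhs_right_gt.
rewrite /GRing.scale/= mulr1 mulrC ler_pdivrMr//.
have gih : leb1.-integrable `]x, (h + x)] (EFin \o g).
  apply: integrableS (gi (h + x)); rewrite ?measurable_itv//.
  by move=> y /=; rewrite !in_itv/= => /andP[xy ->]; rewrite (le_trans x0)// ltW.
have xhx : (BRight x <= BRight (h + x))%O by rewrite leBSide/= lerDr ltW.
have zx : (BLeft 0 <= BRight x)%O by rewrite leBSide.
rewrite /G (Rintegral_itvB (gi _) zx xhx).
rewrite Rintegral_itv_obnd_cbnd//.
have -> : \int[leb1]_(y in `[x, (h + x)]) g y = \int[leb1]_(y in `[x, (h + x)]) f y.
  apply: eq_Rintegral => y; rewrite inE/= in_itv/= => /andP[xy _].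
  by rewrite /g patchE mem_set// halflineE (le_trans x0).
by have := fc x (h + x) x0; rewrite lerDr (ltW h0) addrK; apply.
Unshelve. all: by end_near. Qed.

(* The test function is [expR (lam * t)] times the cutoff of a trapezoid: the
   exponential factor absorbs the dissipation, and what remains bounds the
   average of [expR (lam * t) * e t] over any interval. *)
Lemma exponential_decay e D (lam M e0 : R) : 0 <= e0 ->
  measurable_fun halfline e ->
  {ae leb1, forall t, 0 <= t -> 0 <= e t <= M} ->
  leb1.-integrable halfline (EFin \o D) ->
  {ae leb1, forall t, 0 <= t -> lam * e t <= D t} ->
  (forall psi, energy_test psi ->
    - (\int[leb1]_(t in halfline) (derive1 psi t * e t))
    + (\int[leb1]_(t in halfline) (psi t * D t)) <= psi 0 * e0) ->
  {ae leb1, forall t, 0 <= t -> e t <= expR (- lam * t) * e0}.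
Proof.
move=> e0_ge0 me eM Di leD energy.
have ei (T : R) : leb1.-integrable `[0, T] (EFin \o e).
  apply: (@ae_bounded_integrable _ _ _ _ _ _ M).
  - exact: measurable_itv.
  - exact: leb1_segment.
  - apply: measurable_funS me; [exact: measurable_halfline|].
    exact: segment_halfline.
  apply: ae_imp eM => t et /segment_halfline; rewrite halflineE => /et.
  by move=> /andP[? ?]; rewrite ger0_norm.
pose E t := expR (lam * t).
have cE : continuous E by exact: continuous_expRM.
have dE t : is_derive t (1 : R) E (lam * E t) by exact: is_derive_expRM.
pose F t := E t * e t.
have Fi (T : R) : leb1.-integrable `[0, T] (EFin \o F).
  apply: integrableMr (ei T); [exact: measurable_itv| |].
    by apply: measurable_funTS; exact: continuous_measurable_fun.
  exact: continuous_itv_bounded.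
suff : {ae leb1, forall t, 0 < t -> F t <= e0}.
  move=> /ae_gt0_ge0; apply: ae_imp => t Ft /Ft.
  rewrite /F /E mulNr expRN [_ * e0]mulrC.
  by rewrite -ler_pdivrMr ?invr_gt0 ?expR_gt0// invrK mulrC.
apply: itv_average_le => // a b a0 ab.
(* The cutoff yields the bound up to an excess [d * e0], where [d] is the width of the sloping sides
   of the trapezoid. The excess falls below any [z > 0] for [d = z / (e0 + 1)], where the 1 covers
   the case [e0 = 0]. *)
suff bound (d : R) : 0 < d -> \int[leb1]_(x in `[a, b]) F x <= (b - a + d) * e0.
  apply/ler_addgt0Pr => z z0; pose d := z / (e0 + 1).
  have e1 : 0 < e0 + 1 by rewrite ltr_wpDl.
  have de : d * (e0 + 1) = z by rewrite /d divfK// gt_eqF.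
  have d0 : 0 < d by rewrite divr_gt0.
  by apply: le_trans (bound d d0) _; lra.
move=> d0.
pose k := cutoff a b d; pose h := trapezoid a b d.
pose psi t := E t * k t.
pose psi' t := lam * psi t - E t * h t.
have dpsi (t : R) : is_derive t (1 : R) psi (psi' t).
  have ? := dE t; have ? := is_derive_cutoff a b d t.
  by apply: is_derive_eq; rewrite /GRing.scale/= /psi' /psi -/k -/h; ring.
have ck : continuous k.
  move=> t; apply: differentiable_continuous; apply/derivable1_diffP.
  exact: (@ex_derive _ _ _ _ _ _ _ (is_derive_cutoff a b d t)).
have cpsi : continuous psi by move=> t; apply: cvgM; [exact: cE|exact: ck].
have cEh : continuous (fun t => E t * h t).
  by move=> t; apply: cvgM; [exact: cE|exact: continuous_trapezoid].
have cpsi' : continuous psi'.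
  move=> t; apply: cvgB; last exact: cEh.
  by apply: cvgM; [exact: cvg_cst|exact: cpsi].
have psi0 t : b + d <= t -> psi t = 0.
  by move=> bt; rewrite /psi /k cutoff_eq0// mulr0.
have Eh0 t : b + d <= t -> E t * h t = 0.
  by move=> bt; rewrite /h trapezoid_eq0// mulr0.
have psi'0 t : b + d <= t -> psi' t = 0.
  by move=> bt; rewrite /psi' psi0// Eh0// mulr0 subr0.
have psi_ge0 t : 0 <= psi t by rewrite mulr_ge0 ?expR_ge0 ?cutoff_ge0.
have psi_test : energy_test psi.
  by split=> //; [exact: C1_is_derive1 dpsi cpsi'|exists (b + d)].
have mH := @measurable_halfline.
have psi'i := integrable_halflineM cpsi' psi'0 (ei _).
have psii := integrable_halflineM cpsi psi0 (ei _).
have Ehi := integrable_halflineM cEh Eh0 (ei _).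
have DT : leb1.-integrable `[0, (b + d)] (EFin \o D).
  by apply: integrableS Di => //; exact: segment_halfline.
have psiDi := integrable_halflineM cpsi psi0 DT.
(* The term that the derivative of the exponential adds is absorbed by the dissipation; only the
   [E * h] part of [psi'] survives. *)
have psi_D : lam * \int[leb1]_(t in halfline) (psi t * e t) <=
    \int[leb1]_(t in halfline) (psi t * D t).
  rewrite -RintegralZl//; apply: le_ae_Rintegral => //.
    exact: integrable_scale.
  apply: ae_imp leD => t et; rewrite halflineE => /et le_D.
  by rewrite mulrCA ler_wpM2l.
have psi'E : \int[leb1]_(t in halfline) (derive1 psi t * e t) =
    lam * \int[leb1]_(t in halfline) (psi t * e t)
    - \int[leb1]_(t in halfline) (E t * h t * e t).
  rewrite -RintegralZl// -RintegralB//; last exact: integrable_scale.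
  apply: eq_Rintegral => t _.
  by rewrite derive1E (@derive_val _ _ _ _ _ _ _ (dpsi t)) /psi'; ring.
(* The trapezoid is 1 on [a, b], and elsewhere the integrand is nonnegative almost everywhere. *)
have intF : \int[leb1]_(x in `[a, b]) F x <=
    \int[leb1]_(t in halfline) (E t * h t * e t).
  have abH : `[a, b] `<=` @halfline R.
    by move=> t; rewrite halflineE/= in_itv/= => /andP[+ _]; exact: le_trans.
  rewrite -(setIidr abH) Rintegral_mkcondr; apply: le_ae_Rintegral => //.
    rewrite -restrict_EFin; apply/integrable_restrict => //.
  apply: integrableS (Fi b) => //; first exact: measurableI.
    move=> t []; rewrite halflineE/= !in_itv/= => t0 /andP[_ ->].
    by rewrite t0.
  apply: ae_imp eM => t et; rewrite halflineE => /et/andP[et0 _].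
  rewrite patchE; case: ifPn => [|_]; last first.
    by apply: mulr_ge0 => //; apply: mulr_ge0; [exact: expR_ge0|exact: trapezoid_ge0].
  by rewrite inE/= in_itv/= => tab; rewrite /h trapezoid_eq1// mulr1.
have psi00 : psi 0 * e0 <= (b - a + d) * e0.
  by rewrite ler_wpM2r// /psi /E mulr0 expR0 mul1r cutoff_le.
move: (energy _ psi_test) psi_D intF psi00; rewrite psi'E; clear; lra.
Qed.

End decay.

(** * Lebesgue measure on space *)

Section space.
Context {R : realType}.

Definition rat_box (q : rat * rat * rat * rat) : set (pt R) :=
  ball (ratr q.1.1.1 : R) (ratr q.2) `*` ball (ratr q.1.1.2 : R) (ratr q.2)
  `*` ball (ratr q.1.2 : R) (ratr q.2).

(** The sigma-algebra comes from products of measurable sets and the topology from products of open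
    sets. Cubes with rational centres and radii form a countable family, and those inside an open
    set cover it. *)
Lemma open_measurable_pt (O : set (pt R)) : open O -> measurable O.
Proof.
move=> oO.
have -> : O = \bigcup_(q in [set q | rat_box q `<=` O]) rat_box q.
  apply/seteqP; split=> [x Ox|x [q qO xq]]; last exact: qO.
  have /nbhs_ballP[e /= e0 eO] : nbhs x O by exact: open_nbhs_nbhs.
  have [r /= re] := rat_in_itvoo (divr_gt0 e0 (@ltr0Sn R 1)).
  have : ratr r \in `]0, e / 2[ by exact: re.
  rewrite in_itv/= => /andP[r0 r2].
  have near (y : R) : exists q : rat, ball (ratr q : R) (ratr r) y.
    have [q] := @rat_in_itvoo R (y - ratr r) (y + ratr r) ltac:(lra).
    rewrite in_itv/= => /andP[q1 q2]; exists q.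
    by rewrite /ball/= ltr_distlC; apply/andP; split; lra.
  have [q1 xq1] := near x.1.1; have [q2 xq2] := near x.1.2.
  have [q3 xq3] := near x.2.
  have tri (q : rat) (y z : R) : ball (ratr q : R) (ratr r) y ->
      ball (ratr q : R) (ratr r) z -> ball y e z.
    move=> qy qz; apply: (@ball_splitr _ _ (ratr q : R)).
      by apply: le_ball (ltW r2) _ _; exact: qy.
    by apply: le_ball (ltW r2) _ _; exact: qz.
  exists (q1, q2, q3, r); last by split; [split|].
  move=> y [[/= y1 y2] y3]; apply: eO; split; [split|].
  - exact: tri xq1 y1.
  - exact: tri xq2 y2.
  - exact: tri xq3 y3.
rewrite bigcup_mkcond; apply: countable_bigcupT_measurable => [|q].
  exact: countableP.
case: ifPn => // _.
by apply: measurableX; [apply: measurableX|]; exact: measurable_ball.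
Qed.

Lemma leb3_box (A B C : set R) : measurable A -> measurable B -> measurable C ->
  leb3 (A `*` B `*` C) = (leb1 A * leb1 B * leb1 C)%E.
Proof.
move=> mA mB mC; have mAB : measurable (A `*` B) by exact: measurableX.
apply: etrans (product_measure1E (leb1 \x leb1)%E leb1 mAB mC) _.
by congr (_ * _)%E; exact: product_measure1E.
Qed.

Lemma leb3_sigma_finite : sigma_finite setT (@leb3 R).
Proof.
pose I n : set R := `[(- n%:R), n%:R]%classic.
exists (fun n => I n `*` I n `*` I n).
  apply/esym; rewrite -subTset => -[[x y] z] _.
  have inI (w : R) n : (Num.truncn `|w| < n)%N -> I n w.
    move=> wn; rewrite /I /= in_itv/= -ler_norml.
    by rewrite (le_trans (ltW (truncnS_gt _)))// ler_nat.
  exists (maxn (Num.truncn `|x|) (maxn (Num.truncn `|y|) (Num.truncn `|z|))).+1 => //.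
  by split; [split|]; apply: inI; rewrite ltnS !leq_max leqnn ?orbT.
move=> n; have mI : measurable (I n) by exact: measurable_itv.
have finI : (leb1 (I n) < +oo)%E by exact: leb1_segment.
split; first by apply: measurableX => //; exact: measurableX.
have fI : (leb1 (I n) \is a fin_num)%E by rewrite ge0_fin_numE.
have : (leb1 (I n) * leb1 (I n) * leb1 (I n) < +oo)%E.
  by rewrite ltey_eq !fin_numM.
by rewrite -leb3_box.
Qed.

(* [leb3] seen as a sigma-finite measure: the instance declared by the library
   for a product measure only applies to finite factors. *)
Definition leb3_sf := @leb3 R.
HB.instance Definition _ := Measure.on leb3_sf.
HB.instance Definition _ :=
  Measure_isSigmaFinite.Build _ _ _ leb3_sf leb3_sigma_finite.

(** Tonelli's theorem applies to nonnegative functions on the whole space: [f] is extended by zero,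
    then split into its positive and negative parts. *)
Lemma measurable_integral_section (Om : set (pt R)) (f : R * pt R -> \bar R) :
  measurable Om -> measurable_fun (halfline `*` Om) f ->
  measurable_fun halfline (fun t => \int[leb3]_(x in Om) f (t, x))%E.
Proof.
move=> mOm mf.
have mHO : measurable (@halfline R `*` Om).
  by apply: measurableX => //; exact: measurable_halfline.
pose g := f \_ (halfline `*` Om).
have mg : measurable_fun setT g by exact/(measurable_restrictT f mHO).
pose I := fun t => (\int[leb3]_x g^\+ (t, x) - \int[leb3]_x g^\- (t, x))%E.
apply: (@eq_measurable_fun _ _ _ _ _ I) => [t|].
  move=> tH; rewrite /I [RHS]integral_mkcond [RHS]integralE.
  have gE x : g (t, x) = ((fun x => f (t, x)) \_ Om) x.
    by rewrite /g !patchE in_setX tH.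
  by congr (_ - _)%E; apply: eq_integral => x _; rewrite ?funeposE ?funenegE gE.
apply: measurable_funTS.
have mgp := measurable_fun_fubini_tonelli_F (m2 := leb3_sf) (g^\+)%E
  (measurable_funepos mg).
have mgn := measurable_fun_fubini_tonelli_F (m2 := leb3_sf) (g^\-)%E
  (measurable_funeneg mg).
by apply: emeasurable_funB; [apply: mgp|apply: mgn] => ?.
Qed.

End space.

(** * Rigid bodies *)

Section bodies.
Context {R : realType}.
Implicit Types (A Q : 'M[R]_3) (h Y z : 'cV[R]_3) (x : pt R).

(** The indices appear in the form used by [of_coords]. *)
Lemma I3P (P : 'I_3 -> Prop) : P 0 -> P 1 -> P ord_max -> forall k, P k.
Proof.
move=> P0 P1 P2 [[|[|[|//]]] k3].
- by rewrite (_ : Ordinal k3 = 0)//; exact: val_inj.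
- by rewrite (_ : Ordinal k3 = 1)//; exact: val_inj.
- by rewrite (_ : Ordinal k3 = ord_max)//; exact: val_inj.
Qed.

Lemma of_coordsK (v : 'cV[R]_3) : coords (of_coords v) = v.
Proof. by apply/colP; elim/I3P; rewrite mxE. Qed.

Lemma coordsK x : of_coords (coords x) = x.
Proof. by case: x => [[x1 x2] x3]; rewrite /of_coords !mxE. Qed.

(** A diagonal entry of [A^T *m A] is the sum of the squares of a column, so the columns are unit
    vectors. *)
Lemma SO3_entry_le1 A i j : SO3 A -> `|A i j| <= 1.
Proof.
move=> [AA _]; have := congr1 (fun M : 'M[R]_3 => M j j) AA.
rewrite !mxE eqxx (bigD1 i)//= mxE => Ajj.
have sq : A i j ^+ 2 <= 1.
  rewrite -[leRHS]Ajj expr2 lerDl; apply: sumr_ge0 => k _.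
  by rewrite mxE -expr2 sqr_ge0.
by rewrite -(@expr_le1 _ 2)// -normrX ger0_norm// sqr_ge0.
Qed.

Lemma mulmx_entry_le A z (b : R) k : SO3 A -> (forall j, `|z j 0| <= b) ->
  `|(A *m z) k 0| <= 3 * b.
Proof.
move=> AO zb; rewrite mxE (le_trans (ler_norm_sum _ _ _))//.
have -> : 3 * b = \sum_(j < 3) b by rewrite sumr_const card_ord mulr_natl.
apply: ler_sum => j _; rewrite normrM -[leRHS]mul1r.
by apply: ler_pM => //; exact: SO3_entry_le1.
Qed.

Lemma SO3_tr A : SO3 A -> SO3 A^T.
Proof.
by move=> [AA dA]; split; [rewrite trmxK; exact: mulmx1C|rewrite det_tr].
Qed.

(** A sup-norm ball inside [S] is carried along by the isometry. The cube found in its image has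
    sides parallel to the coordinate axes and a size independent of [A] and [h]. *)
Lemma body_contains_cube (S : set (pt R)) : S° !=set0 ->
  exists (a : R) (v : 'cV[R]_3), 0 < a /\
    forall A h z, SO3 A -> (forall k, `|z k 0| <= 2 * a) ->
      (affine_isometry A h @` S) (of_coords (A *m v + h + z)).
Proof.
move=> [x0 /nbhs_ballP[r /= r0 rS]].
(* Rotating back multiplies the bound [2 * a] on the coordinates by at most 3, and
   [6 * a = r / 2 < r]. *)
exists (r / 12), (coords x0); split; first by rewrite divr_gt0.
move=> A h z AO zr; exists (of_coords (coords x0 + A^T *m z)); last first.
  rewrite /affine_isometry of_coordsK mulmxDr mulmxA.
  by rewrite (mulmx1C AO.1) mul1mx addrAC.
apply: rS; have close k : `|(A^T *m z) k 0| < r.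
  apply: le_lt_trans (mulmx_entry_le k (SO3_tr AO) zr) _; lra.
have closek k : `|coords x0 k 0 - (coords x0 + A^T *m z) k 0| < r.
  by rewrite [X in _ - X]mxE opprD addNKr normrN.
move: (closek 0) (closek 1) (closek ord_max).
by rewrite ![in coords x0 _ _]mxE.
Qed.

Lemma sqnorm_ge_entry (w : 'cV[R]_3) i : w i 0 ^+ 2 <= sqnorm w.
Proof.
rewrite /sqnorm /ddot (bigD1 i)//= big_ord1 -expr2 lerDl.
by apply: sumr_ge0 => k _; rewrite big_ord1 -expr2 sqr_ge0.
Qed.

(* On the corner of the cube where the signs of the coordinates match those of
   the coefficients, all the terms of an affine function add up. *)
Lemma affine_corner_ge (m a : R) (q z : 'I_3 -> R) :
  (forall j, if (0 <= m) == (0 <= q j) then a <= z j else z j <= - a) ->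
  `|m| + a * \sum_j `|q j| <= `|m + \sum_j q j * z j|.
Proof.
move=> zc; rewrite mulr_sumr; case: (leP 0 m) zc => m0 zc.
  have : \sum_j a * `|q j| <= \sum_j q j * z j.
    apply: ler_sum => j _; move: (zc j); case: (leP 0 (q j)) => qj /= zj.
      by rewrite ger0_norm//; clear - qj zj; nra.
    by rewrite ltr0_norm//; clear - qj zj; nra.
  by move=> S; rewrite (ger0_norm m0) (le_trans _ (ler_norm _))// lerD2l.
have : \sum_j q j * z j <= - \sum_j a * `|q j|.
  rewrite -sumrN; apply: ler_sum => j _; move: (zc j).
  case: (leP 0 (q j)) => qj /= zj.
    by rewrite ger0_norm//; clear - qj zj; nra.
  by rewrite ltr0_norm//; clear - qj zj; nra.
move=> S; rewrite (ltr0_norm m0) -[leRHS]normrN.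
by rewrite (le_trans _ (ler_norm _))// opprD lerD2l lerNr.
Qed.

(** Only one corner box of the cube is kept, of volume [a ^+ 3]; on it the [i]-th component of the
    rigid velocity is an affine function without cancellation. *)
Lemma rigid_energy_lower (Om B : set (pt R)) (f : pt R -> R)
    (Y h c : 'cV[R]_3) Q (a r : R) :
  measurable Om -> measurable_fun Om f ->
  {ae leb3, forall x : pt R, Om x -> 0 <= f x} -> 0 < a -> 0 <= r ->
  (forall z, (forall k, `|z k 0| <= 2 * a) -> B (of_coords (c + z))) ->
  {ae leb3, forall x : pt R, B x ->
    r * sqnorm (rigid_velocity Y Q h x) <= (f \_ Om) x} ->
  forall i, ((r * (`|(Y + Q *m (c - h)) i 0| + a * \sum_j `|Q i j|) ^+ 2
             * a ^+ 3)%:E <= \int[leb3]_(x in Om) (f x)%:E)%E.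
Proof.
move=> mOm mf f0 a0 r0 Bc rf i.
set m := (Y + Q *m (c - h)) i 0; set K := r * _.
(* The side of the [k]-th interval follows the signs of [m] and [Q i k], as [affine_corner_ge] asks;
   the distance to [c k 0] is between [a] and [2 * a]. *)
pose J k : set R := if (0 <= m) == (0 <= Q i k)
  then `[c k 0 + a, (c k 0 + 2 * a)]%classic
  else `[(c k 0 - 2 * a), (c k 0 - a)]%classic.
have mJ k : measurable (J k) by rewrite /J; case: ifP => _; exact: measurable_itv.
have leb1J k : leb1 (J k) = a%:E.
  rewrite /J /leb1; case: ifP => _; rewrite lebesgue_measure_itv/= lte_fin ifT.
  - by congr EFin; lra.
  - by lra.
  - by congr EFin; lra.
  - by lra.
pose P := J 0 `*` J 1 `*` J ord_max.
have mP : measurable P by apply: measurableX => //; exact: measurableX.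
have leb3P : leb3 P = (a ^+ 3)%:E.
  by rewrite leb3_box// !leb1J -!EFinM !exprS expr0 mulr1 mulrA.
have PJ x k : P x -> J k (coords x k 0).
  by move=> [[x1 x2] x3]; move: k; elim/I3P; rewrite mxE.
have PB x : P x -> B x /\ K <= r * sqnorm (rigid_velocity Y Q h x).
  move=> Px; pose z := coords x - c.
  have xE : coords x = c + z by rewrite addrC subrK.
  split.
    rewrite -(coordsK x) xE; apply: Bc => k; have := PJ x k Px.
    rewrite /J [z k 0]mxE [(- c) k 0]mxE ler_norml.
    by case: ifP => _; rewrite /= in_itv/= => /andP[? ?]; apply/andP; split; lra.
  rewrite ler_wpM2l// (le_trans _ (sqnorm_ge_entry _ i))//.
  have -> : rigid_velocity Y Q h x i 0 = m + \sum_j Q i j * z j 0.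
    rewrite /rigid_velocity /m xE addrAC mulmxDr addrA mxE.
    by congr (_ + _); rewrite mxE.
  rewrite -[leRHS]ger0_norm ?sqr_ge0// normrX lerXn2r ?nnegrE ?addr_ge0//.
    by rewrite mulr_ge0 ?(ltW a0)// sumr_ge0.
  apply: affine_corner_ge => j; have := PJ x j Px.
  rewrite /J [z j 0]mxE [(- c) j 0]mxE.
  by case: ifP => _; rewrite /= in_itv/= => /andP[? ?]; lra.
(* [f] is nonnegative only almost everywhere on [Om]; its truncation [g] is so everywhere and has
   the same integral. *)
pose g x := Num.max (f x) 0.
have mg : measurable_fun Om g by apply: measurable_maxr => //; exact: measurable_cst.
have -> : (\int[leb3]_(x in Om) (f x)%:E = \int[leb3]_(x in Om) (g x)%:E)%E.
  apply: ae_eq_integral => //; [exact/measurable_EFinP|exact/measurable_EFinP|].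
  by apply: ae_imp f0 => x fx Omx; rewrite /g max_l// fx.
(* The box [P] may leave [Om], so the integrals are compared after extension by zero to the whole
   space. *)
rewrite [leRHS]integral_mkcond.
pose G := (fun x => (g x)%:E) \_ Om.
have mG : measurable_fun setT G.
  by apply/(measurable_restrictT _ mOm); exact/measurable_EFinP.
have G0 x : (0 <= G x)%E.
  by rewrite /G patchE; case: ifP => // _; rewrite lee_fin le_max lexx orbT.
apply: (@le_trans _ _ (\int[leb3]_(x in P) G x)%E); last first.
  exact: ge0_subset_integral.
have -> : ((K * a ^+ 3)%:E = \int[leb3]_(x in P) (cst K%:E) x)%E.
  have -> : (\int[leb3]_(x in P) (cst K%:E) x = K%:E * leb3 P)%E.
    exact: integral_cst.
  by rewrite leb3P -EFinM.
apply: ae_ge0_le_integral => //.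
- by move=> x _; rewrite lee_fin mulr_ge0 ?sqr_ge0.
- exact: measurable_funTS.
apply: ae_imp rf => x rfx Px; have [/rfx fx Kr] := PB x Px.
apply: (@le_trans _ _ ((f \_ Om) x)%:E); first by rewrite lee_fin (le_trans Kr).
rewrite /G !patchE; case: ifP => // _.
by rewrite lee_fin /g le_max lexx.
Qed.

End bodies.

(** * Exponentially decaying derivatives *)

Section limits.
Context {R : realType}.

Lemma continuous_segment_integrable (f : R -> R) (a b : R) : continuous f ->
  leb1.-integrable `[a, b] (EFin \o f).
Proof.
move=> cf; apply: continuous_compact_integrable; first exact: segment_compact.
exact: continuous_subspaceT.
Qed.

Lemma Rintegral_expR_le (C g s t : R) : 0 <= C -> 0 < g -> s < t ->
  \int[leb1]_(r in `[s, t]) (C * expR (- g * r)) <= C / g * expR (- g * s).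
Proof.
move=> C0 g0 st; pose F r := - (C / g) * expR (- g * r).
have dF (r : R) : is_derive r (1 : R) F (C * expR (- g * r)).
  have -> : C * expR (- g * r) = - (C / g) *: (- g * expR (- g * r)).
    by rewrite /GRing.scale/=; field; rewrite gt_eqF.
  exact: is_deriveZ (is_derive_expRM (- g) r).
have cF : continuous F.
  by move=> r; apply: cvgM; [exact: cvg_cst|exact: continuous_expRM].
have cf : continuous (fun r => C * expR (- g * r)).
  by move=> r; apply: cvgM; [exact: cvg_cst|exact: continuous_expRM].
rewrite /Rintegral (@continuous_FTC2 _ _ F _ _ st).
- have : 0 <= C / g * expR (- g * t) by rewrite mulr_ge0 ?expR_ge0 ?divr_ge0// ltW.
  by rewrite /= /F !mulNr opprK gerDr oppr_le0.
- exact: continuous_subspaceT.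
- split; first by move=> x _; exact: (@ex_derive _ _ _ _ _ _ _ (dF x)).
  + exact/cvg_at_right_filter/cF.
  + exact/cvg_at_left_filter/cF.
- by move=> x _; rewrite derive1E (@derive_val _ _ _ _ _ _ _ (dF x)).
Qed.

Lemma expR_decay_lt (C g e : R) : 0 <= C -> 0 < g -> 0 < e ->
  exists2 s : R, 0 <= s & forall t, s <= t -> C * expR (- g * t) < e.
Proof.
(* By [1 + x <= expR x], [expR (g * t)] exceeds [C / e] from this time on. *)
move=> C0 g0 e0; exists (C / (e * g)); first by rewrite divr_ge0// mulr_ge0// ltW.
move=> t st.
have gt1 : C / e <= g * t.
  by rewrite -ler_pdivrMl//; apply: le_trans st; rewrite invfM; lra.
rewrite mulNr expRN ltr_pdivrMr ?expR_gt0// mulrC -ltr_pdivrMr//.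
apply: le_lt_trans gt1 _; apply: lt_le_trans (expR_ge1Dx _).
by rewrite ltrDr.
Qed.

(** Integrating the bound on [f'] over [s, t] gives increments at most [C / g * expR (- g * s)], so
    [f] is Cauchy at infinity. *)
Lemma cvg_of_decaying_derivative (f f' : R -> 'cV[R]_3) (C g : R) :
  0 <= C -> 0 < g -> Linfty_loc f' -> time_derivative f f' ->
  {ae leb1, forall t, 0 <= t -> forall k, `|f' t k 0| <= C * expR (- g * t)} ->
  exists l : 'cV[R]_3, f t @[t --> +oo] --> l.
Proof.
move=> C0 g0 [mf' _] df f'C.
pose y k t := f' t k 0.
have yi k (T : R) : leb1.-integrable `[0, T] (EFin \o y k).
  apply: (@ae_bounded_integrable _ _ _ _ _ _ C).
  - exact: measurable_itv.
  - exact: leb1_segment.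
  - apply: measurable_funS (mf' k 0); [exact: measurable_halfline|].
    exact: segment_halfline.
  apply: ae_imp f'C => t yt /segment_halfline; rewrite halflineE => t0.
  apply: le_trans (yt t0 k) _; rewrite ler_piMr// -expR0 ler_expR.
  by rewrite mulNr oppr_le0 mulr_ge0// ltW.
have dist k (s t : R) : 0 <= s -> s < t ->
    `|f s k 0 - f t k 0| <= C / g * expR (- g * s).
  move=> s0 st; have t0 := le_trans s0 (ltW st).
  have st' : (BRight s <= BRight t)%O by rewrite leBSide/= ltW.
  have zs : (BLeft 0 <= BRight s)%O by rewrite leBSide.
  have yist : leb1.-integrable `]s, t] (EFin \o y k).
    apply: integrableS (yi k t); rewrite ?measurable_itv//.
    by move=> r /=; rewrite !in_itv/= => /andP[sr ->]; rewrite (le_trans s0)// ltW.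
  have yist' : leb1.-integrable `[s, t] (EFin \o y k).
    apply: integrableS (yi k t); rewrite ?measurable_itv//.
    by move=> r /=; rewrite !in_itv/= => /andP[sr ->]; rewrite (le_trans s0).
  rewrite distrC (df t)// (df s)// opprD addrACA subrr add0r.
  rewrite (Rintegral_itvB (yi k t) zs st') Rintegral_itv_obnd_cbnd//.
  apply: le_trans (le_normr_Rintegral _ yist') _; first exact: measurable_itv.
  apply: le_trans (Rintegral_expR_le C0 g0 st).
  apply: le_ae_Rintegral.
  - exact: measurable_itv.
  - exact: integrable_norm yist'.
  - apply: continuous_segment_integrable => r.
    by apply: cvgM; [exact: cvg_cst|exact: continuous_expRM].
  apply: ae_imp f'C => r yr; rewrite /= in_itv/= => /andP[sr _].
  exact: yr (le_trans s0 sr) k.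
exists (lim (f t @[t --> +oo])); apply: cauchy_cvg; apply: cauchy_exP => e e0.
have [s s0 sP] := @expR_decay_lt (C / g) g e (divr_ge0 C0 (ltW g0)) g0 e0.
exists (f s); exists s; split; first exact: num_real.
move=> t st; split=> // k j; rewrite (ord1 j) /ball/=.
by apply: le_lt_trans (dist k s t s0 st) _; exact: sP.
Qed.

Lemma mx_norm_lt m n (A : 'M[R]_(m, n)) (e : R) : 0 < e ->
  (forall i j, `|A i j| < e) -> `|A| < e.
Proof.
move=> e0 Ae; have : ball 0 e A by split=> // i j; rewrite /ball/= mxE sub0r normrN.
by rewrite mx_norm_ball /ball_/= sub0r normrN.
Qed.

End limits.

(** * Energy of the fluid-structure system *)

Section pointwise.
Context {R : realType}.

Lemma sqnorm_ge0 m n (A : 'M[R]_(m, n)) : 0 <= sqnorm A.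
Proof. by apply: sumr_ge0 => i _; apply: sumr_ge0 => j _; rewrite -expr2 sqr_ge0. Qed.

Lemma sqnorm0 m n : sqnorm (0 : 'M[R]_(m, n)) = 0.
Proof. by apply: big1 => i _; apply: big1 => j _; rewrite mxE mul0r. Qed.

Lemma ddot0l m n (A : 'M[R]_(m, n)) : ddot 0 A = 0.
Proof. by apply: big1 => i _; apply: big1 => j _; rewrite mxE mul0r. Qed.

Lemma ddot_stress (mu : R) (A : 'M[R]_3) : ddot (stress mu A) A = mu * sqnorm A.
Proof.
rewrite /sqnorm /ddot mulr_sumr; apply: eq_bigr => i _.
by rewrite mulr_sumr; apply: eq_bigr => j _; rewrite mxE mulrA.
Qed.

Lemma sqnorm_tr (A : 'M[R]_3) : sqnorm A^T = sqnorm A.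
Proof.
rewrite /sqnorm /ddot exchange_big; apply: eq_bigr => i _.
by apply: eq_bigr => j _; rewrite mxE.
Qed.

(** Entry by entry, the square of a mean is at most the mean of the squares; transposing preserves
    [sqnorm]. *)
Lemma sqnorm_sym_le (A : 'M[R]_3) : sqnorm (sym A) <= sqnorm A.
Proof.
have -> : sqnorm A = 2^-1 * (sqnorm A + sqnorm A^T).
  by rewrite sqnorm_tr; field.
rewrite /sqnorm /ddot -big_split mulr_sumr; apply: ler_sum => i _.
rewrite -big_split mulr_sumr; apply: ler_sum => j _.
rewrite !mxE /=; have := sqr_ge0 (A i j - A j i); rewrite expr2.
move: (A i j) (A j i) => a b ab.
have -> : 2^-1 * (a + b) * (2^-1 * (a + b)) =
    2^-1 * (a * a + b * b) - 4^-1 * ((a - b) * (a - b)) by field.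
by rewrite gerBl; lra.
Qed.

Lemma measurable_fun_ddot d (T : measurableType d) m n (D : set T)
    (f g : T -> 'M[R]_(m, n)) : mx_measurable D f -> mx_measurable D g ->
  measurable_fun D (fun x => ddot (f x) (g x)).
Proof.
move=> mf mg; apply: measurable_sum => i; apply: measurable_sum => j.
exact: measurable_funM.
Qed.

Lemma mx_measurable_sym d (T : measurableType d) (D : set T)
    (f : T -> 'M[R]_3) : mx_measurable D f -> mx_measurable D (fun x => sym (f x)).
Proof.
move=> mf i j.
have -> : (fun x => sym (f x) i j) = (fun x => 2^-1 * (f x i j + f x j i)).
  by apply/funext => x; rewrite !mxE.
by apply: measurable_funM; [exact: measurable_cst|exact: measurable_funD].
Qed.

End pointwise.

Section energy.
Context {R : realType}.

(** Outside the bodies the density is 1, whence the minimum with 1 below and the condition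
    [1 <= rhomax] above. *)
Lemma density_between N (Om : set (pt R)) (B : 'I_N -> set (pt R))
    (rhoS : 'I_N -> R) (r : pt R -> R) (rhomin rhomax : R) :
  (forall i, rhomin <= rhoS i <= rhomax) -> 1 <= rhomax ->
  {ae leb3, forall x : pt R, Om x -> (forall i, ~ B i x) -> r x = 1} ->
  (forall i, {ae leb3, forall x : pt R, Om x -> B i x -> r x = rhoS i}) ->
  {ae leb3, forall x : pt R, Om x -> Num.min rhomin 1 <= r x <= rhomax}.
Proof.
move=> rS max1 fluid /ae_forall_fin bodies.
apply: ae_imp2 fluid bodies => x fx bx Omx.
have [[i Bx]|nB] := pselect (exists i, B i x).
  have /andP[? ?] := rS i; rewrite (bx i)// ge_min.
  by apply/andP; split=> //; apply/orP; left.
rewrite fx// ?ge_min ?lexx ?orbT// => i Bx.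
by apply: nB; exists i.
Qed.

(** The third conclusion says that the extended integral is finite, and so links the real-valued
    energy inequality to estimates in the extended reals. *)
Lemma kinetic_energy_bounds (Om : set (pt R)) (r : pt R -> R)
    (v : pt R -> 'cV[R]_3) (rhomax : R) :
  measurable Om -> measurable_fun Om r -> L2 Om v -> 0 <= rhomax ->
  {ae leb3, forall x : pt R, Om x -> 0 <= r x <= rhomax} ->
  [/\ leb3.-integrable Om (EFin \o (fun x => r x * sqnorm (v x))),
      0 <= \int[leb3]_(x in Om) (r x * sqnorm (v x)),
      (\int[leb3]_(x in Om) (r x * sqnorm (v x))%:E =
        (\int[leb3]_(x in Om) (r x * sqnorm (v x)))%R%:E)%E &
      \int[leb3]_(x in Om) (r x * sqnorm (v x)) <=
        rhomax * \int[leb3]_(x in Om) (sqnorm (v x))].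
Proof.
move=> mOm mr [mv v2] rmax0 rb.
have msq : measurable_fun Om (fun x => sqnorm (v x)) by exact: measurable_fun_ddot.
have mrs : measurable_fun Om (fun x => r x * sqnorm (v x)) by exact: measurable_funM.
have sqi : leb3.-integrable Om (EFin \o (fun x => sqnorm (v x))).
  apply/integrableP; split; first exact/measurable_EFinP.
  apply: le_lt_trans v2; rewrite le_eqVlt; apply/orP; left; apply/eqP.
  by apply: eq_integral => x _; rewrite /= ger0_norm ?sqnorm_ge0.
have rsqi : leb3.-integrable Om (EFin \o (fun x => rhomax * sqnorm (v x))).
  exact: integrable_scale.
have ri : leb3.-integrable Om (EFin \o (fun x => r x * sqnorm (v x))).
  apply/integrableP; split; first exact/measurable_EFinP.
  have /integrableP[mrsq] := rsqi; apply: le_lt_trans.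
  apply: ae_ge0_le_integral => //.
  - by apply: measurableT_comp => //; exact/measurable_EFinP.
  - exact: measurableT_comp.
  apply: ae_imp rb => x rx /rx/andP[r0 rM].
  rewrite /= lee_fin !normrM ler_wpM2r//.
  by rewrite ger0_norm// ger0_norm.
split=> //.
- have <- : \int[leb3]_(x in Om) 0 = 0 by rewrite Rintegral_cst// mul0r.
  apply: le_ae_Rintegral => //; first exact: integrable0.
  by apply: ae_imp rb => x rx /rx/andP[r0 _]; rewrite mulr_ge0 ?sqnorm_ge0.
- by rewrite /Rintegral fineK//; exact: integrable_fin_num.
rewrite -RintegralZl//; apply: le_ae_Rintegral => //.
by apply: ae_imp rb => x rx /rx/andP[_ rM]; rewrite ler_wpM2r ?sqnorm_ge0.
Qed.

(** Serves to show that the dissipation is finite at almost every time and integrable in time. *)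
Lemma dissipation_le (Om : set (pt R)) (G : pt R -> 'M[R]_3) (mu : R) :
  measurable Om -> 0 < mu -> mx_measurable Om G ->
  (\int[leb3]_(x in Om) (ddot (stress mu (sym (G x))) (sym (G x)))%:E <=
   mu%:E * \int[leb3]_(x in Om) (sqnorm (G x))%:E)%E.
Proof.
move=> mOm mu0 mG.
have msq : measurable_fun Om (fun x => sqnorm (G x)) by exact: measurable_fun_ddot.
have msym : measurable_fun Om (fun x => sqnorm (sym (G x))).
  by apply: measurable_fun_ddot; exact: mx_measurable_sym.
rewrite -ge0_integralZl//; last 3 first.
- exact/measurable_EFinP.
- by move=> x _; rewrite lee_fin sqnorm_ge0.
- by rewrite lee_fin ltW.
apply: ge0_le_integral => //.
- by move=> x _; rewrite lee_fin ddot_stress mulr_ge0 ?sqnorm_ge0// ltW.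
- apply/measurable_EFinP; under eq_fun do rewrite ddot_stress.
  by apply: measurable_funM => //; exact: measurable_cst.
- apply/measurable_EFinP.
  by apply: measurable_funM => //; exact: measurable_cst.
by move=> x _; rewrite lee_fin ddot_stress ler_wpM2l ?sqnorm_sym_le// ltW.
Qed.

End energy.

(** * Decay of the energy and of the rigid velocities for a given solution without force *)

Section solution.
Context {R : realType} {N : nat}.
Variables (Om : set (pt R)) (S : 'I_N -> set (pt R))
  (A0 : 'I_N -> 'M[R]_3) (h0 : 'I_N -> 'cV[R]_3)
  (rhoS : 'I_N -> R) (rhomin rhomax mu CKP : R)
  (rho0 : pt R -> R) (u0 : pt R -> 'cV[R]_3)
  (rho : R -> pt R -> R) (u : R -> pt R -> 'cV[R]_3)
  (Du : R -> pt R -> 'M[R]_3)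
  (A : 'I_N -> R -> 'M[R]_3) (h : 'I_N -> R -> 'cV[R]_3)
  (Y : 'I_N -> R -> 'cV[R]_3) (Q : 'I_N -> R -> 'M[R]_3).
Hypotheses (mOm : measurable Om) (mu_gt0 : 0 < mu) (rhomin_gt0 : 0 < rhomin)
  (rhoS_bounds : forall i, rhomin <= rhoS i <= rhomax)
  (fluid_bound : 1 <= rhomax) (CKP_gt0 : 0 < CKP)
  (Korn_Poincare : forall v G, W120 Om v G ->
     (CKP%:E * \int[leb3]_(x in Om) (sqnorm (v x))%:E <=
      \int[leb3]_(x in Om) (ddot (stress mu (sym (G x))) (sym (G x)))%:E)%E)
  (data : finite_energy_data Om S A0 h0 rhoS rho0 u0)
  (sol : dissipative_weak_solution Om S A0 h0 rhoS mu (fun _ _ => 0) rho0 u0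
           rho u Du A h Y Q).

Let rmin := Num.min rhomin 1.
Let lam := 2 * CKP / rhomax.
Let K t := \int[leb3]_(x in Om) (rho t x * sqnorm (u t x)).
Let K0 := \int[leb3]_(x in Om) (rho0 x * sqnorm (u0 x)).

Let rmin_gt0 : 0 < rmin.
Proof. by rewrite lt_min rhomin_gt0 ltr01. Qed.

Let rhomax_gt0 : 0 < rhomax.
Proof. exact: lt_le_trans fluid_bound. Qed.

Let nonneg_bounds (r : pt R -> R) :
  {ae leb3, forall x : pt R, Om x -> rmin <= r x <= rhomax} ->
  {ae leb3, forall x : pt R, Om x -> 0 <= r x <= rhomax}.
Proof.
apply: ae_imp => x rx /rx /andP[r0 ->]; rewrite andbT.
exact: le_trans (ltW rmin_gt0) r0.
Qed.

Lemma density_bounds : {ae leb1, forall t : R, 0 < t ->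
  {ae leb3, forall x : pt R, Om x -> rmin <= rho t x <= rhomax}}.
Proof.
have := ae_forall_fin (compat_body sol).
apply: ae_imp2 (compat_fluid sol) => t ft bt t0.
by apply: density_between (ft t0) _ => // i; exact: bt.
Qed.

Lemma initial_energy_bounds :
  0 <= K0 /\ (\int[leb3]_(x in Om) (rho0 x * sqnorm (u0 x))%:E = K0%:E)%E.
Proof.
have r0 := density_between rhoS_bounds fluid_bound (rho0_fluid data) (rho0_body data).
by have [] := kinetic_energy_bounds mOm (rho0_measurable data) (u0_L2 data)
  (ltW rhomax_gt0) (nonneg_bounds r0).
Qed.

(** Gathers what holds at almost every time, so that the estimates below can be made at one fixed
    time. *)
Record regular_time (t : R) : Prop := RegularTime {
  rt_rho : measurable_fun Om (rho t) ;
  rt_W120 : W120 Om (u t) (Du t) ;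
  rt_density : {ae leb3, forall x : pt R, Om x -> rmin <= rho t x <= rhomax} }.

Lemma ae_regular_time : {ae leb1, forall t : R, 0 < t -> regular_time t}.
Proof.
apply: ae_imp2 (u_W120 sol) density_bounds => t Wt rt t0.
split; [|exact: Wt|exact: rt].
by have /integrableP[/measurable_EFinP] := rho_L1 sol (ltW t0).
Qed.

Lemma energy_bounds t : regular_time t ->
  [/\ leb3.-integrable Om (EFin \o (fun x => rho t x * sqnorm (u t x))),
      0 <= K t,
      (\int[leb3]_(x in Om) (rho t x * sqnorm (u t x))%:E = (K t)%:E)%E &
      K t <= rhomax * \int[leb3]_(x in Om) (sqnorm (u t x))].
Proof.
move=> [mr [[u2 _ _] _] rb].
exact: kinetic_energy_bounds (ltW rhomax_gt0) (nonneg_bounds rb).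
Qed.

Let e t := \int[leb3]_(x in Om) (2^-1 * rho t x * sqnorm (u t x)).
Let De t := (\int[leb3]_(x in Om)
  (ddot (stress mu (sym (Du t x))) (sym (Du t x)))%:E)%E.

Let De_ge0 t : (0 <= De t)%E.
Proof.
by apply: integral_ge0 => x _; rewrite lee_fin ddot_stress mulr_ge0 ?sqnorm_ge0// ltW.
Qed.

Let eE t : regular_time t -> e t = 2^-1 * K t.
Proof.
move=> /energy_bounds[i _ _ _]; rewrite /e /K -RintegralZl//.
by apply: eq_Rintegral => x _; rewrite mulrA.
Qed.

Lemma measurable_energy : measurable_fun halfline e.
Proof.
have mf : measurable_fun (halfline `*` Om)
    (fun p : R * pt R => 2^-1 * rho p.1 p.2 * sqnorm (u p.1 p.2)).
  apply: measurable_funM.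
    by apply: measurable_funM; [exact: measurable_cst|exact: rho_measurable sol].
  by apply: measurable_fun_ddot; exact: u_measurable sol.
apply: (measurableT_comp (fine_measurable measurableT)).
apply: (measurable_integral_section (f := fun p : R * pt R =>
  (2^-1 * rho p.1 p.2 * sqnorm (u p.1 p.2))%:E)) => //.
exact/measurable_EFinP.
Qed.

Lemma measurable_dissipation : measurable_fun halfline De.
Proof.
apply: (measurable_integral_section (f := fun p : R * pt R =>
  (ddot (stress mu (sym (Du p.1 p.2))) (sym (Du p.1 p.2)))%:E)) => //.
apply/measurable_EFinP; under eq_fun do rewrite ddot_stress.
apply: measurable_funM; first exact: measurable_cst.
by apply: measurable_fun_ddot; apply: mx_measurable_sym; exact: Du_measurable sol.
Qed.

(** The dissipation is dominated by [mu] times the squared W^{1,2} norm of the velocity, integrable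
    in time by [u_L2_W12]. *)
Lemma integrable_dissipation :
  leb1.-integrable halfline (EFin \o (fun t => fine (De t))).
Proof.
pose I t := (\int[leb3]_(x in Om) (sqnorm (u t x) + sqnorm (Du t x))%:E)%E.
have mI : measurable_fun halfline I.
  apply: (measurable_integral_section (f := fun p : R * pt R =>
    (sqnorm (u p.1 p.2) + sqnorm (Du p.1 p.2))%:E)) => //.
  apply/measurable_EFinP; apply: measurable_funD; apply: measurable_fun_ddot;
    by [exact: u_measurable sol|exact: Du_measurable sol].
have I0 t : (0 <= I t)%E.
  by apply: integral_ge0 => x _; rewrite lee_fin addr_ge0 ?sqnorm_ge0.
have mfD : measurable_fun halfline (fun t => fine (De t)).
  exact: measurableT_comp (fine_measurable measurableT) measurable_dissipation.
apply/integrableP; split; first exact/measurable_EFinP.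
apply: (@le_lt_trans _ _ (\int[leb1]_(t in halfline) (mu%:E * I t))%E); last first.
  rewrite ge0_integralZl ?lee_fin ?(ltW mu_gt0)//; last exact: measurable_halfline.
  by apply: lte_mul_pinfty; [rewrite lee_fin ltW| |exact: u_L2_W12 sol].
apply: ae_ge0_le_integral.
- exact: measurable_halfline.
- by move=> t _.
- by apply: measurableT_comp => //; exact/measurable_EFinP.
- by move=> t _; rewrite mule_ge0// lee_fin ltW.
- exact: measurable_funeM.
have := ae_gt0_ge0 ae_regular_time; apply: ae_imp => t rt.
rewrite halflineE => /rt[_ [[[mut _] [mDu _] _] _] _].
have DI : (De t <= mu%:E * I t)%E.
  apply: le_trans (dissipation_le mOm mu_gt0 mDu) _.
  apply: lee_wpmul2l; first by rewrite lee_fin ltW.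
  apply: ge0_le_integral => //.
  - by move=> x _; rewrite lee_fin sqnorm_ge0.
  - by apply/measurable_EFinP; exact: measurable_fun_ddot.
  - apply/measurable_EFinP.
    by apply: measurable_funD; exact: measurable_fun_ddot.
  - by move=> x _; rewrite lee_fin lerDr sqnorm_ge0.
apply: le_trans DI; rewrite /= ger0_norm ?fine_ge0//.
(* [fine] sends an infinite value to 0, so [fine (De t)] is at most the nonnegative [De t] in every
   case. *)
by move: (De_ge0 t); case: (De t) => //= _; exact: leey.
Qed.

(** Korn-Poincare bounds the dissipation below by [CKP] times the squared L^2 norm of [u], which is
    at least [K t / rhomax]; the factor 2 in [lam] comes from [e] being half of [K]. *)
Lemma energy_dissipation t : regular_time t -> lam * e t <= fine (De t).
Proof.
move=> rt; have [_ _ _ KU] := energy_bounds rt.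
have [_ [[[mut u2] [mDu D2] _] _] _] := rt.
have := Korn_Poincare (rt_W120 rt); rewrite -/(De t).
have Dfin : De t \is a fin_num.
  rewrite ge0_fin_numE//; apply: le_lt_trans (dissipation_le mOm mu_gt0 mDu) _.
  apply: lte_mul_pinfty => //; by rewrite ?lee_fin ?ltW.
have Ufin : (\int[leb3]_(x in Om) (sqnorm (u t x))%:E)%E \is a fin_num.
  by rewrite ge0_fin_numE//; apply: integral_ge0 => x _; rewrite lee_fin sqnorm_ge0.
rewrite -(fineK Dfin) -(fineK Ufin) -EFinM lee_fin; apply: le_trans.
rewrite eE// /lam.
have -> : 2 * CKP / rhomax * (2^-1 * K t) = CKP * (K t / rhomax).
  by field; rewrite gt_eqF.
by apply: ler_wpM2l; rewrite ?(ltW CKP_gt0)// ler_pdivrMr// mulrC.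
Qed.

Lemma energy_decay :
  {ae leb1, forall t, 0 <= t -> regular_time t /\ K t <= expR (- lam * t) * K0}.
Proof.
have [M uM] := u_Linfty_L2 sol.
have [K0_ge0 _] := initial_energy_bounds.
have reg := ae_gt0_ge0 ae_regular_time.
have decay : {ae leb1, forall t, 0 <= t -> e t <= expR (- lam * t) * (2^-1 * K0)}.
  (* The a priori bound on [e] combines [rho <= rhomax] with the uniform bound [M] on the squared
     L^2 norm. *)
  apply: (@exponential_decay _ e (fun t => fine (De t)) lam (2^-1 * (rhomax * M))).
  - by rewrite mulr_ge0// invr_ge0.
  - exact: measurable_energy.
  - apply: ae_imp2 reg uM => t rt ut t0.
    have [_ Kt0 _ KU] := energy_bounds (rt t0).
    rewrite eE; last exact: rt.
    have UM : \int[leb3]_(x in Om) (sqnorm (u t x)) <= M.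
      rewrite -lee_fin /Rintegral fineK ?ut// ge0_fin_numE.
        exact: le_lt_trans (ut t0) (ltry _).
      by apply: integral_ge0 => x _; rewrite lee_fin sqnorm_ge0.
    rewrite mulr_ge0 ?invr_ge0//= ler_wpM2l ?invr_ge0//.
    by apply: le_trans KU _; rewrite ler_wpM2l// ltW.
  - exact: integrable_dissipation.
  - by apply: ae_imp reg => t rt t0; apply: energy_dissipation; exact: rt.
  move=> psi psit; have := energy_inequality sol psit.
  (* There is no force, so its work vanishes. *)
  have -> : \int[leb1]_(t in halfline) (psi t *
      \int[leb3]_(x in Om) (rho t x * ddot (0 : 'cV[R]_3) (u t x))) = 0.
    rewrite (_ : 0 = \int[leb1]_(t in @halfline R) 0); last first.
      by rewrite Rintegral_cst ?mul0r//; exact: measurable_halfline.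
    apply: eq_Rintegral => t _.
    rewrite (_ : Rintegral _ _ _ = \int[leb3]_(x in Om) 0).
      by rewrite Rintegral_cst// mul0r mulr0.
    by apply: eq_Rintegral => x _; rewrite ddot0l mulr0.
  by rewrite addr0 -/K0 [2^-1 * _]mulrC -mulrA.
apply: ae_imp2 reg decay => t rt et t0; split; first exact: rt.
have := et t0; rewrite eE; last exact: rt.
by rewrite mulrCA ler_pM2l.
Qed.

(** The cube is centred at the material point [A i t *m v + h i t], whose rigid velocity has the
    component appearing here; its size [a] is the same at all times. *)
Lemma rigid_motion_energy i (t a : R) (v : 'cV[R]_3) : 0 < a ->
  (forall M b (z : 'cV[R]_3), SO3 M -> (forall k, `|z k 0| <= 2 * a) ->
    (affine_isometry M b @` S i) (of_coords (M *m v + b + z))) ->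
  regular_time t -> SO3 (A i t) ->
  {ae leb3, forall x : pt R, body S A h i t x ->
    \1_Om x *: u t x = rigid_velocity (Y i t) (Q i t) (h i t) x} ->
  forall k, rmin * (`|(Y i t + Q i t *m (A i t *m v)) k 0|
    + a * \sum_j `|Q i t k j|) ^+ 2 * a ^+ 3 <= K t.
Proof.
move=> a0 cube rt AO uE k.
have [/measurable_int/measurable_EFinP mf _ KE _] := energy_bounds rt.
have -> : A i t *m v = (A i t *m v + h i t) - h i t by rewrite addrK.
rewrite -lee_fin -KE; apply: (@rigid_energy_lower _ _ (body S A h i t)) => //.
- apply: ae_imp (nonneg_bounds (rt_density rt)) => x rx /rx/andP[r0 _].
  by rewrite mulr_ge0 ?sqnorm_ge0.
- exact: ltW.
- by move=> z zb; exact: cube.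
apply: ae_imp2 uE (rt_density rt) => x ux rx Bx; rewrite -(ux Bx) patchE.
case: ifPn => xOm.
  have /andP[rm _] := rx (set_mem xOm).
  by rewrite indicE xOm scale1r ler_wpM2r ?sqnorm_ge0.
(* Outside [Om] the extended velocity is 0, hence so is the rigid one, and both sides vanish. *)
by rewrite indicE (negbTE xOm) scale0r sqnorm0 mulr0.
Qed.

(** The energy controls the squares of the velocities, which halves the rate. It bounds [Q] and the
    velocity of the centre of the cube; [Y] is recovered by subtracting the contribution of the
    rotation. *)
Lemma rigid_velocity_decay i : (S i)° !=set0 ->
  exists2 C : R, 0 <= C & {ae leb1, forall t, 0 <= t -> forall k,
    `|Y i t k 0| <= C * expR (- (lam / 2) * t) /\
    forall j, `|Q i t k j| <= C * expR (- (lam / 2) * t)}.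
Proof.
move=> /body_contains_cube[a [v [a0 cube]]].
have [K0_ge0 _] := initial_energy_bounds.
(* [X] bounds every entry of the rotated vector [A i t *m v]. *)
pose X := 3 * \sum_j `|v j 0|.
pose B0 := Num.sqrt (K0 / (rmin * a ^+ 3)).
have ra : 0 < rmin * a ^+ 3 by rewrite mulr_gt0// exprn_gt0.
have B0_ge0 : 0 <= B0 by exact: sqrtr_ge0.
have X0 : 0 <= X by rewrite mulr_ge0// sumr_ge0.
have C0 : 0 <= B0 * (1 + X / a) + B0 / a.
  apply: addr_ge0; last by rewrite divr_ge0// ltW.
  by rewrite mulr_ge0// addr_ge0// divr_ge0// ltW.
(* [B0 * (1 + X / a)] serves for [Y] and [B0 / a] for [Q]; their sum serves for both. *)
exists (B0 * (1 + X / a) + B0 / a) => //.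
apply: ae_imp2 energy_decay (ae_gt0_ge0 (compat_velocity sol i)) => t Kt ut t0 k.
have [rt KE] := Kt t0.
have AO := motion_SO3 sol i t0.
have := rigid_motion_energy a0 cube rt AO (ut t0) k.
set m := (Y i t + _) k 0; set q := \sum_j `|Q i t k j|; set E := expR _.
move=> mqK; have q0 : 0 <= q by exact: sumr_ge0.
have E0 : 0 <= E by exact: expR_ge0.
have mq0 : 0 <= `|m| + a * q by rewrite addr_ge0// mulr_ge0// ltW.
have mqE : `|m| + a * q <= B0 * E.
  rewrite -(@ler_pXn2r _ 2)// ?nnegrE ?mulr_ge0// exprMn sqr_sqrtr; last first.
    by rewrite divr_ge0// ltW.
  have -> : E ^+ 2 = expR (- lam * t).
    by rewrite expr2 /E -expRD; congr expR; field.
  rewrite [leRHS]mulrAC ler_pdivlMr// [leRHS]mulrC.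
  by apply: le_trans KE; rewrite mulrCA mulrA.
have aq : q <= B0 / a * E.
  rewrite mulrAC ler_pdivlMr// mulrC; apply: le_trans mqE.
  by rewrite lerDr.
split=> [|j]; last first.
  have Qq : `|Q i t k j| <= q.
    by rewrite /q (bigD1 j)//= lerDl sumr_ge0.
  apply: le_trans Qq _; apply: le_trans aq _; rewrite ler_wpM2r// lerDr.
  by rewrite mulr_ge0// addr_ge0// divr_ge0// ltW.
have -> : Y i t k 0 = m - (Q i t *m (A i t *m v)) k 0 by rewrite /m mxE addrK.
have QAv : `|(Q i t *m (A i t *m v)) k 0| <= X * q.
  rewrite mxE (le_trans (ler_norm_sum _ _ _))// mulr_sumr; apply: ler_sum => j _.
  rewrite normrM mulrC ler_wpM2r//; apply: mulmx_entry_le => // l.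
  by rewrite (bigD1 l)//= lerDl sumr_ge0.
have mE : `|m| <= B0 * E by apply: le_trans mqE; rewrite lerDl mulr_ge0// ltW.
have XqE : X * q <= X * (B0 / a * E) by rewrite ler_wpM2l.
have BaE : 0 <= B0 / a * E by rewrite mulr_ge0// divr_ge0// ltW.
apply: le_trans (ler_normB _ _) _; apply: le_trans (lerD mE QAv) _.
rewrite (_ : (_ + B0 / a) * E = B0 * E + X * (B0 / a * E) + B0 / a * E).
  by rewrite -[leLHS]addr0 lerD// lerD2l.
by field; rewrite gt_eqF.
Qed.

Lemma lam_gt0 : 0 < lam.
Proof. by rewrite divr_gt0// mulr_gt0. Qed.

End solution.

Unset Implicit Arguments.

(** The conditions on [u] and [Q] hold at almost every time only, so the energy bound is stated for
    almost every [tau] and the limit of [Q] is an essential one; [h] is an integral of [Y] and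
    converges in the ordinary sense. *)
Theorem theorem3p1 (R : realType) (N : nat) (Om : set (pt R))
  (S : 'I_N -> set (pt R))
  (A0 : 'I_N -> 'M[R]_3) (h0 : 'I_N -> 'cV[R]_3)
  (rhoS : 'I_N -> R) (rhomin rhomax mu CKP : R)
  (rho0 : pt R -> R) (u0 : pt R -> 'cV[R]_3)
  (rho : R -> pt R -> R) (u : R -> pt R -> 'cV[R]_3)
  (Du : R -> pt R -> 'M[R]_3)
  (A : 'I_N -> R -> 'M[R]_3) (h : 'I_N -> R -> 'cV[R]_3)
  (Y : 'I_N -> R -> 'cV[R]_3) (Q : 'I_N -> R -> 'M[R]_3)
  (N_ge1 : (1 <= N)%N)
  (Om_domain : [/\ open Om, connected Om, bounded_set Om & Om !=set0])
  (mu_gt0 : 0 < mu)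
  (S_compact : forall i, compact (S i))
  (S_connected : forall i, connected (S i))
  (S_interior : forall i, (S i)° !=set0)
  (S_regular : forall i, S i = closure (S i)°)
  (S_centered : forall i, center_of_mass (S i) = 0)
  (A0_SO3 : forall i, SO3 (A0 i))
  (S0_sub : forall i, (initial_body S A0 h0 i)° `<=` Om)
  (S0_disjoint : forall i j, i != j ->
     (initial_body S A0 h0 i)° `&` (initial_body S A0 h0 j)° = set0)
  (rhomin_gt0 : 0 < rhomin)
  (rhoS_bounds : forall i, rhomin <= rhoS i <= rhomax)
  (* [rhomax] bounds the whole density, which equals 1 in the fluid: the decay
     rate 2 CKP / rhomax is false when rhomax is small. *)
  (fluid_bound : 1 <= rhomax)
  (CKP_gt0 : 0 < CKP)
  (Korn_Poincare : forall v G, W120 Om v G ->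
     (CKP%:E * \int[leb3]_(x in Om) (sqnorm (v x))%:E <=
      \int[leb3]_(x in Om) (ddot (stress mu (sym (G x))) (sym (G x)))%:E)%E)
  (data : finite_energy_data Om S A0 h0 rhoS rho0 u0)
  (sol : dissipative_weak_solution Om S A0 h0 rhoS mu (fun _ _ => 0) rho0 u0
           rho u Du A h Y Q) :
  {ae leb1, forall tau : R, 0 <= tau ->
     (\int[leb3]_(x in Om) (rho tau x * sqnorm (u tau x))%:E <=
      (expR (- (2 * CKP / rhomax) * tau))%:E *
        \int[leb3]_(x in Om) (rho0 x * sqnorm (u0 x))%:E)%E} /\
  exists hinf : 'I_N -> 'cV[R]_3, forall i,
    h i tau @[tau --> +oo] --> hinf i /\
    (forall e : R, 0 < e ->
       exists T : R, {ae leb1, forall tau, T < tau -> `|Q i tau| < e}).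
Proof.
have mOm : measurable Om by case: Om_domain => + _ _ _; exact: open_measurable_pt.
have decay := energy_decay mOm mu_gt0 rhomin_gt0 rhoS_bounds fluid_bound CKP_gt0
  Korn_Poincare data sol.
have [_ K0E] := initial_energy_bounds mOm rhomin_gt0 rhoS_bounds fluid_bound data.
split.
  apply: ae_imp decay => t Kt t0; have [rt KE] := Kt t0.
  have [_ _ -> _] := energy_bounds mOm rhomin_gt0 fluid_bound rt.
  by rewrite K0E -EFinM lee_fin.
(* Half the decay rate of the energy: velocities decay like its square root. *)
pose g := 2 * CKP / rhomax / 2.
have g0 : 0 < g by rewrite divr_gt0// lam_gt0.
suff limits i : exists l : 'cV[R]_3, h i tau @[tau --> +oo] --> l /\
    (forall e : R, 0 < e ->
       exists T : R, {ae leb1, forall tau, T < tau -> `|Q i tau| < e}).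
  by have [hinf hinfP] := choice limits; exists hinf.
have [C C0 YQ] := rigid_velocity_decay mOm mu_gt0 rhomin_gt0 rhoS_bounds
  fluid_bound CKP_gt0 Korn_Poincare data sol (S_interior i).
have [LY dh] := motion_Y sol i.
have [l hl] : exists l : 'cV[R]_3, h i tau @[tau --> +oo] --> l.
  apply: cvg_of_decaying_derivative C0 g0 LY dh _.
  by apply: ae_imp YQ => t YQt t0 k; have [] := YQt t0 k.
exists l; split=> // e e0; have [T T0 CT] := expR_decay_lt C0 g0 e0.
exists T; apply: ae_imp YQ => t YQt Tt; apply: mx_norm_lt => // k j.
have [_ /(_ j) Qkj] := YQt (le_trans T0 (ltW Tt)) k.
by apply: le_lt_trans Qkj _; exact: CT (ltW Tt).
Qed.
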